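(* Let $n,k$ be integers with $1<k\le n$. Let $\mathcal{F}$ be a family of $2n+k-3$ non-empty sets of edges in a bipartite graph, such that the union of every $k$ members of $\mathcal{F}$ contains a matching of size $n$. Then there exists an $\mathcal{F}$-rainbow matching of size $n$.
   Context: ''Family'' means multiset: members may repeat, and repeated copies count as distinct members. For a family $\mathcal{F}=(F_1,\dots,F_m)$ of sets, an $\mathcal{F}$-rainbow set is the image of a partial choice function of $\mathcal{F}$, i.e. a set $\{x_{i_j}\mid j\le r\}$ where $1\le i_1<\dots<i_r\le m$ and $x_{i_j}\in F_{i_j}$. An $\mathcal{F}$-rainbow matching is an $\mathcal{F}$-rainbow set of edges that is a matching (its edges are pairwise disjoint); its size is its number of edges. *)

(* Defs.v *)
From HB Require Import structures.
From mathcomp Require Export all_boot finmap.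
From mathcomp Require Export boolp classical_sets.

Set Implicit Arguments.
Unset Strict Implicit.
Unset Printing Implicit Defensive.

Local Open Scope fset_scope.
Local Open Scope classical_set_scope.

Record sgraph (V : choiceType) := SGraph {
  adj : rel V;
  adj_sym : symmetric adj;
  adj_irr : irreflexive adj
}.

Section Graph.
Variables (V : choiceType) (G : sgraph V).

Definition edges : set {fset V} :=
  [set e | exists x y : V, adj G x y /\ e = [fset x; y]].

Definition bipartite : Prop :=
  exists A : set V, forall x y : V, adj G x y -> (A x <-> ~ A y).

Definition matching (M : {fset {fset V}}) : Prop :=
  [set` M] `<=` edges /\
  (forall e f : {fset V}, e \in M -> f \in M -> e != f -> [disjoint e & f]%fset).

End Graph.

(* A family of m sets is a function on 'I_m, so repeated members are told
   apart by their indices.  A partial choice function is f : 'I_m -> option T,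
   with f i = None when i is outside its domain; it need not be injective. *)
Definition rainbow_set (T : choiceType) (m : nat) (F : 'I_m -> set T)
    (M : {fset T}) : Prop :=
  exists f : 'I_m -> option T,
    (forall i x, f i = Some x -> F i x) /\
    (forall x, x \in M <-> exists i, f i = Some x).

(* Main.v *)
(** Suppose there is no rainbow matching of size n and let M be one of size
p = n-1, with the p+k-1 unused colours.  The M-alternating paths form a network
whose p inner vertices are the edges of M; by Koenig every k colours contain a
source-sink path, and no path is rainbow.  Contracting an arc at the source
shows by induction on p that such a network is "regimented": the vertices split
into paths Q_1, ..., Q_g, and the colours into groups U_1, ..., U_g with
|U_i| = |Q_i|, every colour of U_i containing all of the path Q_i, and k-1 >= 1
further colours, whose arcs all stay in some Q_i and do not go forward.

Such a further colour u is non-empty.  If it contains an edge of M, give that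
edge the colour u: the colour so freed then completes a rainbow path.
Otherwise u contains a back arc in some Q_i; switching M along the
cycle it closes, with colours of U_i on the other arcs, gives a matching M' of
the same size.  If there is a second group U_j, then a colour freed by the
switch can be used for the first arc of a path continued along Q_j with U_j,
which is rainbow.  So there is only one group, for M' as well as for M, and its
path is Hamiltonian for M'; but a colour of U_i not used by the switch contains
a path for M' that skips vertices. *)
Require Import Defs.
From mathcomp Require Import all_boot finmap.
From mathcomp Require Import boolp classical_sets.
From mathcomp Require Import zify.

Set Implicit Arguments.
Unset Strict Implicit.
Unset Printing Implicit Defensive.

(** * Regimented networks *)

Section Networks.
Variables C N : eqType.
Implicit Types (A : C -> rel N) (V : seq N) (s t x y : N) (c d e : C).

(* Only a subsequence of the listed colours need be used. *)
Fixpoint rainbow_walk A V t x (cs : seq C) : Prop :=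
  if cs is c :: cs' then
    [\/ A c x t,
        exists y, [/\ y \in V, A c x y & rainbow_walk A V t y cs'] |
        rainbow_walk A V t x cs']
  else False.

Lemma rainbow_walk_sub A V V' t x cs : {subset V <= V'} ->
  rainbow_walk A V t x cs -> rainbow_walk A V' t x cs.
Proof.
move=> sV; elim: cs x => //= c cs IH x [Axt|[y [Vy Axy wy]]|wx].
- by constructor 1.
- by constructor 2; exists y; split; [exact: sV | | exact: IH].
- by constructor 3; exact: IH.
Qed.

(* The last visit of a walk to y starts a walk that never returns to y. *)
Lemma rainbow_walk_avoid A V t x y cs : rainbow_walk A V t x cs ->
  rainbow_walk A (filter (predC1 y) V) t x cs \/
  rainbow_walk A (filter (predC1 y) V) t y cs.
Proof.
elim: cs x => //= c cs IH x [Axt|[z [Vz Axz wz]]|wx].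
- by left; constructor 1.
- case: (IH _ wz) => [wz'|]; last by right; constructor 3.
  have [ezy|nzy] := eqVneq z y.
    by right; constructor 3; rewrite -ezy in wz' *.
  by left; constructor 2; exists z; split=> //; rewrite mem_filter /= nzy.
- by case: (IH _ wx) => ?; [left|right]; constructor 3.
Qed.

Lemma rainbow_walk_path A V t x q cs cs' : {subset q <= V} ->
    (forall d, d \in cs -> path (A d) x q) -> size q <= size cs ->
  rainbow_walk A V t (last x q) cs' -> rainbow_walk A V t x (cs ++ cs').
Proof.
elim: cs q x => [|c cs IH] [|y q] x //= sq pq sz w.
  by constructor 3; apply: (IH [::]).
have /andP[Axy _] := pq c (mem_head _ _).
constructor 2; exists y; split=> //; first by apply: sq; rewrite mem_head.
apply: IH w => // [z zq|d dcs]; first by apply: sq; rewrite inE zq orbT.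
by have /= /andP[] := pq d (mem_behead (s := c :: cs) dcs).
Qed.

Lemma rainbow_walk_last A V t x q cs : {subset q <= V} ->
    (forall d, d \in cs -> path (A d) x (rcons q t)) -> size q < size cs ->
  rainbow_walk A V t x cs.
Proof.
elim: cs q x => [|c cs IH] [|y q] x //= sq pq sz.
  by have /andP[Axt _] := pq c (mem_head _ _); constructor 1.
have /andP[Axy _] := pq c (mem_head _ _).
constructor 2; exists y; split=> //; first by apply: sq; rewrite mem_head.
apply: (IH q) => // [z zq|d dcs]; first by apply: sq; rewrite inE zq orbT.
by have /= /andP[] := pq d (mem_behead (s := c :: cs) dcs).
Qed.

Definition no_rainbow A V s t (U : seq C) :=
  forall cs, uniq cs -> {subset cs <= U} -> ~ rainbow_walk A V t s cs.

Definition cut_arc A V s t (K : seq C) := forall X : pred N,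
  exists c x y, [/\ c \in K, A c x y, x = s \/ x \in V /\ X x
                  & y = t \/ y \in V /\ ~~ X y].

(** A member of [G] lists the inner vertices of a path from [s] to [t] and the colours of its group.
    The path has one more arc than inner vertices, so [reg_size] leaves the group one colour short
    of a rainbow path. That the arcs of [R] do not go forward is derived later, in
    [arc_colour_R]. *)
Record regimented A V s t (U : seq C) (G : seq (seq N * seq C)) (R : seq C) :=
 Regimented {
  reg_nodes : perm_eq (flatten (map fst G)) V;
  reg_colours : perm_eq (flatten (map snd G) ++ R) U;
  reg_size : forall g, g \in G -> size g.1 = size g.2;
  reg_neq0 : forall g, g \in G -> 0 < size g.1;
  reg_path : forall g d, g \in G -> d \in g.2 -> path (A d) s (rcons g.1 t)
 }.

Lemma uniq_flatten_neq0 (I T : eqType) (f : I -> seq T) (G : seq I) :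
  uniq (flatten (map f G)) -> (forall g, g \in G -> 0 < size (f g)) -> uniq G.
Proof.
elim: G => //= a G IH; rewrite cat_uniq => /and3P[_ dis uG] pos.
rewrite IH ?andbT // => [|g gG]; last by apply: pos; rewrite inE gG orbT.
apply/negP=> aG; have := pos a (mem_head _ _).
case fa : (f a) => [|z l] // _; move/negP: dis; apply; apply/hasP; exists z.
  by apply/flattenP; exists (f a); [exact: map_f | rewrite fa mem_head].
by rewrite /= fa mem_head.
Qed.

Lemma size_remE (T : eqType) (z : T) (l : seq T) : size (rem z l) = size l - (z \in l).
Proof.
have [zl|zl] := boolP (z \in l); first by rewrite size_rem // subn1.
by rewrite rem_id //= subn0.
Qed.

Lemma uniq_flatten_disjoint (I T : eqType) (f : I -> seq T) (G : seq I) g h z :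
  uniq (flatten (map f G)) -> g \in G -> h \in G -> z \in f g -> z \in f h ->
  g = h.
Proof.
elim: G => //= a G IH; rewrite cat_uniq => /and3P[_ dis uG].
have dis' b : b \in G -> z \in f a -> z \in f b -> False.
  move=> bG za zb; move/negP: dis; apply; apply/hasP; exists z => //.
  by apply/flattenP; exists (f b) => //; exact: map_f.
rewrite !inE => /orP[/eqP->|gG] /orP[/eqP->|hG] zg zh //.
- by case: (dis' h).
- by case: (dis' g).
- exact: IH.
Qed.

Lemma uniq_flatten_in (I T : eqType) (f : I -> seq T) (G : seq I) g :
  uniq (flatten (map f G)) -> g \in G -> uniq (f g).
Proof.
elim: G => //= a G IH; rewrite cat_uniq => /and3P[ua _ uG].
by rewrite inE => /orP[/eqP->|]//; exact: IH.
Qed.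

(** * Arcs of a regimented network without a rainbow path *)

Section RegimentedTheory.
Variables (A : C -> rel N) (V : seq N) (s t : N) (U : seq C).
Variables (G : seq (seq N * seq C)) (R : seq C).
Hypotheses (uV : uniq V) (uU : uniq U).
Hypothesis reg : regimented A V s t U G R.

Lemma regP x : x \in V -> exists g q1 q2, g \in G /\ g.1 = q1 ++ x :: q2.
Proof.
rewrite -(perm_mem (reg_nodes reg)) => /flattenP[_ /mapP[g gG ->] xg].
by case/path.splitPr: {2}(g.1) / xg (erefl g.1) => q1 q2 e; exists g, q1, q2.
Qed.

Lemma reg_subV g : g \in G -> {subset g.1 <= V}.
Proof.
move=> gG x xg; rewrite -(perm_mem (reg_nodes reg)).
by apply/flattenP; exists g.1 => //; exact: map_f.
Qed.

Lemma reg_subU g : g \in G -> {subset g.2 <= U}.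
Proof.
move=> gG x xg; rewrite -(perm_mem (reg_colours reg)) mem_cat.
by apply/orP; left; apply/flattenP; exists g.2 => //; exact: map_f.
Qed.

Lemma reg_subR : {subset R <= U}.
Proof. by move=> x xR; rewrite -(perm_mem (reg_colours reg)) mem_cat xR orbT. Qed.

Lemma reg_uniq : uniq (flatten (map snd G) ++ R).
Proof. by rewrite (perm_uniq (reg_colours reg)). Qed.

Lemma reg_uniqR : uniq R.
Proof. by have := reg_uniq; rewrite cat_uniq => /and3P[]. Qed.

Lemma reg_uniq2 g : g \in G -> uniq g.2.
Proof.
by have := reg_uniq; rewrite cat_uniq => /and3P[u _ _]; exact: uniq_flatten_in.
Qed.

Lemma reg_uniqG : uniq G.
Proof.
apply: (@uniq_flatten_neq0 _ _ fst); last exact: reg_neq0 reg.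
by rewrite (perm_uniq (reg_nodes reg)).
Qed.

Lemma reg_uniq1 g : g \in G -> uniq g.1.
Proof.
by apply: uniq_flatten_in; rewrite (perm_uniq (reg_nodes reg)).
Qed.

Lemma reg_notinR g c : g \in G -> c \in R -> c \notin g.2.
Proof.
move=> gG cR; apply/negP=> cg; have := reg_uniq; rewrite cat_uniq.
case/and3P=> _ /hasP[]; exists c => //.
by apply/flattenP; exists g.2 => //; exact: map_f.
Qed.

Lemma reg_disj2 g h c : g \in G -> h \in G -> c \in g.2 -> c \in h.2 -> g = h.
Proof.
have := reg_uniq; rewrite cat_uniq => /and3P[u _ _].
exact: uniq_flatten_disjoint.
Qed.

Lemma reg_disj1 g h x : g \in G -> h \in G -> x \in g.1 -> x \in h.1 -> g = h.
Proof.
by apply: uniq_flatten_disjoint; rewrite (perm_uniq (reg_nodes reg)).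
Qed.

Lemma reg_suffix g q1 y q2 L : g \in G -> g.1 = q1 ++ y :: q2 ->
  {subset L <= g.2} -> size q2 < size L -> rainbow_walk A V t y L.
Proof.
move=> gG eg sL sz; apply: (@rainbow_walk_last _ _ _ _ q2) => //.
  by move=> z zq; apply: (reg_subV gG); rewrite eg mem_cat inE zq !orbT.
move=> d /sL dg; have := reg_path reg gG dg.
by rewrite eg rcons_cat cat_path /= => /and3P[].
Qed.

Lemma reg_prefix g q1 x q2 L cs : g \in G -> g.1 = q1 ++ x :: q2 ->
  {subset L <= g.2} -> size q1 < size L -> rainbow_walk A V t x cs ->
  rainbow_walk A V t s (L ++ cs).
Proof.
move=> gG eg sL sz w; apply: (@rainbow_walk_path _ _ _ _ (rcons q1 x)).
- by move=> z zq; apply: (reg_subV gG); rewrite eg -cat_rcons mem_cat zq.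
- move=> d /sL dg; have := reg_path reg gG dg.
  by rewrite eg -cat_rcons rcons_cat cat_path => /andP[].
- by rewrite size_rcons.
- by rewrite last_rcons.
Qed.

Lemma arc_walk_to_group c x g q1 y q2 L : A c x y -> g \in G ->
  g.1 = q1 ++ y :: q2 -> {subset L <= g.2} -> size q2 < size L ->
  rainbow_walk A V t x (c :: L).
Proof.
move=> Axy gG eg sL sz; constructor 2; exists y; split=> //.
  by apply: (reg_subV gG); rewrite eg mem_cat mem_head orbT.
exact: reg_suffix eg sL sz.
Qed.

Lemma start_walk c y : A c s y -> y = t \/ y \in V ->
  exists2 L, rainbow_walk A V t s (c :: L) &
    L = [::] \/ exists g, [/\ g \in G, y \in g.1 & L = g.2].
Proof.
move=> Asy [ey|/regP[g [q1 [q2 [gG eg]]]]].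
  by exists [::]; [constructor 1; rewrite -ey | left].
exists g.2; last by right; exists g; rewrite eg mem_cat mem_head orbT.
apply: (arc_walk_to_group Asy gG eg) => //.
by rewrite -(reg_size reg gG) eg size_cat /=; clear; lia.
Qed.

Lemma cross_walk c x y g q1 q2 h r1 r2 L L' : A c x y -> g \in G -> h \in G ->
    g.1 = q1 ++ x :: q2 -> h.1 = r1 ++ y :: r2 ->
    {subset L <= g.2} -> {subset L' <= h.2} ->
    size q1 < size L -> size r2 < size L' ->
  rainbow_walk A V t s (L ++ c :: L').
Proof.
move=> Axy gG hG eg eh sL sL' sz sz'; apply: (reg_prefix gG eg) => //.
exact: arc_walk_to_group eh sL' sz'.
Qed.

Hypothesis nr : no_rainbow A V s t U.

(** From a vertex that is not first in its group, the rest of the path needs fewer colours than the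
    group has, so it can be completed even without [c]. From the first vertex all colours of the
    group are needed, and only [c] being one of them prevents a rainbow path. *)
Lemma arc_from_start c y : c \in U -> A c s y -> y = t \/ y \in V ->
  exists g q2, [/\ g \in G, c \in g.2 & g.1 = y :: q2].
Proof.
move=> cU Asy [ey|/regP[g [[|z q1] [q2 [gG eg]]]]].
- by case: (@nr [:: c]) => //= [z|]; [rewrite inE => /eqP->|constructor 1; rewrite -ey].
- exists g, q2; split=> //; apply: contraT => cg; case: (@nr (c :: g.2)).
    by rewrite /= cg (reg_uniq2 gG).
    by move=> z; rewrite inE => /orP[/eqP->//|]; exact: reg_subU.
  by apply: (arc_walk_to_group Asy gG eg) => //; rewrite -(reg_size reg gG) eg.
- case: (@nr (c :: rem c g.2)).
  + by rewrite /= mem_rem_uniq ?rem_uniq ?(reg_uniq2 gG) // inE eqxx.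
  + by move=> w; rewrite inE => /orP[/eqP->//|/mem_rem]; exact: reg_subU.
  + apply: (arc_walk_to_group Asy gG eg) => [w /mem_rem//|].
    by rewrite size_remE -(reg_size reg gG) eg size_cat /=; clear; lia.
Qed.

Lemma arc_to_end c x : c \in U -> A c x t -> x \in V ->
  exists g q1, [/\ g \in G, c \in g.2 & g.1 = rcons q1 x].
Proof.
move=> cU Axt /regP[g [q1 [q2 [gG eg]]]].
have w L : {subset L <= g.2} -> size q1 < size L -> c \notin L -> uniq L -> False.
  move=> sL sz cL uL; case: (@nr (L ++ [:: c])).
  - by rewrite cat_uniq uL /= (negbTE cL).
  - by move=> w; rewrite mem_cat inE => /orP[/sL/(reg_subU gG)|/eqP->].
  - by apply: (reg_prefix gG eg) => //; constructor 1.
have [cg|cg] := boolP (c \in g.2); last first.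
  case: (w g.2) => //; last exact: reg_uniq2.
  by rewrite -(reg_size reg gG) eg size_cat /=; clear; lia.
case: q2 eg => [|z q2] eg; first by exists g, q1; rewrite eg cats1.
case: (w (rem c g.2)).
- by move=> ? /mem_rem.
- by rewrite size_remE -(reg_size reg gG) eg size_cat /=; clear; lia.
- by rewrite mem_rem_uniq ?(reg_uniq2 gG) // inE eqxx.
- by rewrite rem_uniq ?(reg_uniq2 gG).
Qed.

(** Reaching [x] along [g] takes [size q1 + 1] colours, and reaching [t] from [y] along [h] takes
    [size r2 + 1]. The listed cases are those in which the groups, deprived of [c], cannot pay for
    both. *)
Lemma inner_arc c x y g q1 q2 h r1 r2 : c \in U -> A c x y ->
    g \in G -> h \in G -> g.1 = q1 ++ x :: q2 -> h.1 = r1 ++ y :: r2 ->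
  [\/ g = h /\ size r1 <= size q1 + (c \in g.2),
      c \in g.2 /\ q2 = [::] | c \in h.2 /\ r1 = [::]].
Proof.
move=> cU Axy gG hG eg eh.
have ug := rem_uniq c (reg_uniq2 gG); have uh := rem_uniq c (reg_uniq2 hG).
have ncg : c \notin rem c g.2 by rewrite mem_rem_uniq ?(reg_uniq2 gG) // inE eqxx.
have nch : c \notin rem c h.2 by rewrite mem_rem_uniq ?(reg_uniq2 hG) // inE eqxx.
have w L L' : {subset L <= rem c g.2} -> {subset L' <= rem c h.2} ->
    uniq L -> uniq L' -> ~~ has [in L] L' ->
    size q1 < size L -> size r2 < size L' -> False.
  move=> sL sL' uL uL' dL sz sz'; case: (@nr (L ++ c :: L')).
  - rewrite cat_uniq uL /= uL' negb_or dL !andbT.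
    by rewrite (contra (@sL c) ncg) (contra (@sL' c) nch).
  - move=> z; rewrite mem_cat inE => /or3P[/sL/mem_rem|/eqP->//|/sL'/mem_rem];
      exact: reg_subU.
  - by apply: (cross_walk Axy gG hG eg eh) => // z /[dup] => [/sL/mem_rem|/sL'/mem_rem].
have := reg_size reg gG; rewrite eg size_cat /= => szg.
have := reg_size reg hG; rewrite eh size_cat /= => szh.
have [egh|ngh] := eqVneq g h.
  have [le|gt] := leqP (size r1) (size q1 + (c \in g.2)); first by constructor 1.
  have szD : size q1 + size r2 + 2 <= size (rem c g.2).
    move: gt szg szh; rewrite size_remE -egh => + <-.
    by case: (c \in g.2) => /=; clear; lia.
  (* The first [size q1 + 1] colours of the common group serve the way to [x], the others the way
     from [y]. *)
  exfalso; apply: (w (take (size q1).+1 (rem c g.2)) (drop (size q1).+1 (rem c g.2))).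
  - by move=> z /mem_take.
  - by move=> z /mem_drop; rewrite egh.
  - exact: take_uniq.
  - exact: drop_uniq.
  - by have := ug; rewrite -{1}(cat_take_drop (size q1).+1 (rem c g.2)) cat_uniq => /and3P[].
  - by rewrite size_takel //; move: szD; clear; lia.
  - by rewrite size_drop; move: szD; clear; lia.
have disj : ~~ has [in rem c g.2] (rem c h.2).
  apply/hasPn => z /mem_rem zh; apply/negP=> /= /mem_rem zg; case/eqP: ngh.
  exact: reg_disj2 zg zh.
have [cg|cg] := boolP (c \in g.2).
  have ch : c \notin h.2.
    by apply/negP=> ch; case/eqP: ngh; exact: reg_disj2 cg ch.
  case: q2 eg szg => [|z q2] eg szg; first by constructor 2.
  by case: (w (rem c g.2) (rem c h.2)) => //;
    rewrite size_remE ?cg ?(negbTE ch) -?szg -?szh /=; clear; lia.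
have [ch|ch] := boolP (c \in h.2).
  case: r1 eh szh => [|z r1] eh szh; first by constructor 3.
  by case: (w (rem c g.2) (rem c h.2)) => //;
    rewrite size_remE ?ch ?(negbTE cg) -?szg -?szh /=; clear; lia.
by case: (w (rem c g.2) (rem c h.2)) => //;
    rewrite size_remE ?(negbTE ch) ?(negbTE cg) -?szg -?szh /=; clear; lia.
Qed.

(** Arcs at [s] or [t], between two groups, or advancing within a group all require a colour that
    belongs to a group. *)
Lemma arc_colour_R c x y : c \in R -> A c x y ->
    x = s \/ x \in V -> y = t \/ y \in V ->
  exists g q1 q2 r1 r2, [/\ g \in G, g.1 = q1 ++ x :: q2,
    g.1 = r1 ++ y :: r2 & size r1 <= size q1].
Proof.
move=> cR Axy; have cU := reg_subR cR.
have ncg g : g \in G -> c \in g.2 -> False.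
  by move=> gG; apply/negP; exact: reg_notinR.
case=> [ex|xV].
  rewrite {}ex in Axy => /(arc_from_start cU Axy)[g [q2 [gG cg _]]].
  by case: (ncg g).
case=> [ey|/regP[h [r1 [r2 [hG eh]]]]].
  rewrite {}ey in Axy; have [g [q1 [gG cg _]]] := arc_to_end cU Axy xV.
  by case: (ncg g).
have [g [q1 [q2 [gG eg]]]] := regP xV.
case: (inner_arc cU Axy gG hG eg eh) => [[egh]|[]/ncg//|[]/ncg//].
have [/ncg//|_] := boolP (c \in g.2); rewrite addn0 => le.
by exists g, q1, q2, r1, r2; split=> //; rewrite egh.
Qed.

(** The cut around [s] alone is crossed, and no colour of [R] can cross it. *)
Lemma start_arc e : cut_arc A V s t (rcons R e) ->
  exists2 y, A e s y & y = t \/ y \in V.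
Proof.
move=> /(_ xpred0)[c [x [y [cR Axy [ex|[//]]]]]].
move=> yt; have {}yt : y = t \/ y \in V by case: yt => [|[]]; [left|right].
move: cR Axy; rewrite {}ex mem_rcons inE => /orP[/eqP->|cR] Asy; first by exists y.
have [g [q2 [gG cg _]]] := arc_from_start (reg_subR cR) Asy yt.
by have := reg_notinR gG cR; rewrite cg.
Qed.

End RegimentedTheory.
(** Contraction of an arc from [s] to [v]: the source takes over the arcs leaving [v]. Arcs into [v]
    survive but are harmless, since [v] is also removed from the list of vertices. *)
Definition contract A s v : C -> rel N :=
  fun c x y => A c x y || (x == s) && A c v y.

Lemma contract_arc A s v c x y : x != s -> contract A s v c x y = A c x y.
Proof. by move=> /negbTE nx; rewrite /contract nx orbF. Qed.

Lemma contract_path A s v t c x q : s \notin x :: q ->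
  path (contract A s v c) x (rcons q t) = path (A c) x (rcons q t).
Proof.
elim: q x => [|y q IH] x; rewrite in_cons negb_or => /andP[nx sq] /=.
  by rewrite contract_arc // eq_sym.
by rewrite IH // contract_arc // eq_sym.
Qed.

Lemma contract_walk A V s v t x cs : s \notin V -> x != s ->
  rainbow_walk (contract A s v) V t x cs -> rainbow_walk A V t x cs.
Proof.
move=> sV; elim: cs x => //= c cs IH x nx; rewrite contract_arc //.
case=> [?|[y [yV]]|/(IH _ nx)]; [by constructor 1| |by constructor 3].
rewrite contract_arc // => Axy w; constructor 2; exists y; split=> //.
by apply: IH w; apply: contraNneq sV => <-.
Qed.

(** Only the first arc can be one taken over from [v], because the walk does not return to [s]. *)
Lemma contract_walk_start A V s v t cs : s \notin V ->
  rainbow_walk (contract A s v) V t s cs ->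
  rainbow_walk A V t s cs \/ rainbow_walk A V t v cs.
Proof.
move=> sV; elim: cs => //= c cs IH [|[y [yV]]|/IH[]].
- by rewrite /contract eqxx => /orP[]; [left|right]; constructor 1.
- move=> Asy w; have {}w : rainbow_walk A V t y cs.
    by apply: contract_walk w => //; apply: contraNneq sV => <-.
  move: Asy; rewrite /contract eqxx => /orP[] Asy; [left|right];
    by constructor 2; exists y.
- by left; constructor 3.
- by right; constructor 3.
Qed.

(** * Undoing the contraction of one arc at the source *)

Section RegimentedStep.
Variables (k : nat) (A : C -> rel N) (V : seq N) (s t : N) (U : seq C).
Hypotheses (uV : uniq V) (uU : uniq U) (sV : s \notin V) (tV : t \notin V).
Hypothesis cuts : forall K, uniq K -> {subset K <= U} -> size K = k ->
  cut_arc A V s t K.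
Hypothesis nr : no_rainbow A V s t U.
Variables (c : C) (v : N) (G : seq (seq N * seq C)) (R : seq C).
Hypotheses (cU : c \in U) (vV : v \in V) (Asv : A c s v).
Let V' := rem v V.
Let U' := rem c U.
Let A' := contract A s v.
Hypothesis reg : regimented A' V' s t U' G R.
Hypothesis szR : (size R).+1 = k.

Let uV' : uniq V'. Proof. exact: rem_uniq. Qed.
Let uU' : uniq U'. Proof. exact: rem_uniq. Qed.
Let sV'V : {subset V' <= V}. Proof. exact: mem_rem. Qed.
Let sU'U : {subset U' <= U}. Proof. exact: mem_rem. Qed.
Let cU' : c \notin U'. Proof. by rewrite mem_rem_uniq // inE eqxx. Qed.
Let sV' : s \notin V'. Proof. by apply: contra sV; exact: sV'V. Qed.
Let tV' : t \notin V'. Proof. by apply: contra tV; exact: sV'V. Qed.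
Let neqs x : x \in V' -> x != s.
Proof. by apply: contraTneq => ->. Qed.
Let inV' x : x \in V -> x = v \/ x \in V'.
Proof. by move=> xV; rewrite mem_rem_uniq // inE xV andbT; case: eqVneq; [left|right]. Qed.
Let AA' d x y : A d x y -> A' d x y.
Proof. by rewrite /A' /contract => ->. Qed.

(** A rainbow walk whose first arc was taken over from [v] is completed by the arc from [s] to [v],
    whose colour [c] is not in [U']. *)
Let nr' : no_rainbow A' V' s t U'.
Proof.
move=> cs ucs scs /(contract_walk_start sV')[]/(rainbow_walk_sub sV'V) w.
  by apply: (nr ucs) w => z /scs/sU'U.
apply: (nr (cs := c :: cs)).
- by rewrite /= ucs andbT; apply: contra cU'; exact: scs.
- by move=> z; rewrite inE => /orP[/eqP->//|/scs/sU'U].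
- by constructor 2; exists v.
Qed.

(** [R] has [k - 1] colours, so one further colour gets every cut crossed. With a well-chosen cut
    that colour is forced to contain a prescribed arc, as the arcs of [R] do not go forward. *)
Let cutR e : e \in U -> e \notin R -> cut_arc A V s t (rcons R e).
Proof.
move=> eU eR; apply: cuts; rewrite ?rcons_uniq ?eR ?(reg_uniqR uU' reg) ?size_rcons //.
by move=> z; rewrite mem_rcons inE => /orP[/eqP->//|/(reg_subR reg)/sU'U].
Qed.

Let cR : c \notin R.
Proof. by apply: contra cU'; exact: (reg_subR reg). Qed.

Let noR e y : e \in R -> A e s y \/ A e v y -> y = t \/ y \in V' -> False.
Proof.
move=> eR Ay yV; have A'y : A' e s y.
  by rewrite /A' /contract eqxx; case: Ay => ->; rewrite ?orbT.
have [|g [q1 [q2 [_ [_ [gG eg _ _]]]]]] := arc_colour_R uU' reg nr' eR A'y _ yV.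
  by left.
by case/negP: sV'; apply: (reg_subV reg gG); rewrite eg mem_cat mem_head orbT.
Qed.

Let suffix g q1 y q2 L : g \in G -> g.1 = q1 ++ y :: q2 ->
  {subset L <= g.2} -> size q2 < size L ->
  forall e x, A e x y -> rainbow_walk A V t x (e :: L).
Proof.
move=> gG eg sL sz e x Axy; have yV' : y \in V'.
  by apply: (reg_subV reg gG); rewrite eg mem_cat mem_head orbT.
constructor 2; exists y; split=> //; first exact: sV'V.
apply: (rainbow_walk_sub sV'V); apply: contract_walk (neqs yV') _ => //.
exact: (reg_suffix reg gG eg).
Qed.

Let suffix_group g q1 y q2 : g \in G -> g.1 = q1 ++ y :: q2 ->
  forall e x, A e x y -> rainbow_walk A V t x (e :: g.2).
Proof.
move=> gG eg; apply: (suffix gG eg) => //.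
by rewrite -(reg_size reg gG) eg size_cat /=; clear; lia.
Qed.

Let prefix g q1 x q2 L cs : g \in G -> g.1 = q1 ++ x :: q2 ->
  (forall d, d \in L -> path (A d) s (rcons g.1 t)) -> size q1 < size L ->
  rainbow_walk A V t x cs -> rainbow_walk A V t s (L ++ cs).
Proof.
move=> gG eg pL sz w; apply: (@rainbow_walk_path _ _ _ _ (rcons q1 x)).
- move=> z zq; apply/sV'V/(reg_subV reg gG).
  by rewrite eg -cat_rcons mem_cat zq.
- by move=> d /pL; rewrite eg -cat_rcons rcons_cat cat_path => /andP[].
- by rewrite size_rcons.
- by rewrite last_rcons.
Qed.

Let subU g : g \in G -> {subset g.2 <= U'}.
Proof. exact: (reg_subU reg). Qed.

Let cG g : g \in G -> c \notin g.2.
Proof. by move=> gG; apply: contra cU'; exact: subU. Qed.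

Let c_not_start y : A c s y -> y = t \/ y \in V' -> False.
Proof.
move=> Asy [ey|/(regP reg)[g [q1 [q2 [gG eg]]]]].
  apply: (nr (cs := [:: c])) => //= [z|]; first by rewrite inE => /eqP->.
  by constructor 1; rewrite -ey.
apply: (nr (cs := c :: g.2)); last exact: (suffix_group gG eg).
  by rewrite /= cG // (reg_uniq2 uU' reg).
by move=> z; rewrite inE => /orP[/eqP->//|/(subU gG)/sU'U].
Qed.

(** If [d] took over the arc into [v], then [c] would be free for the continuation from [v]. *)
Let no_to_v d L : d \in U' -> d \notin L -> uniq L -> {subset L <= U'} ->
  rainbow_walk A V t v (c :: L) -> ~~ A d s v.
Proof.
move=> dU' dL uL sL w; apply/negP=> Adv.
apply: (nr (cs := d :: c :: L)); last by constructor 2; exists v.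
  rewrite /= inE negb_or dL uL (contra (@sL c) cU') !andbT.
  by apply: contraNneq cU' => <-.
by move=> z; rewrite !inE => /or3P[/eqP->|/eqP->|/sL]//; exact: sU'U.
Qed.

(** The cut has [s] and [v] on the source side. By [noR] no colour of [R] crosses it, and by
    [c_not_start] the crossing arc of [c] does not leave [s]. *)
Let c_from_v : exists2 y, A c v y & y = t \/ y \in V'.
Proof.
have [e [x [y [eRc Axy xs yt]]]] := cutR cU cR (pred1 v).
have {}yt : y = t \/ y \in V'.
  case: yt => [|[/inV'[->|]]]; [by left| |by right].
  by rewrite /= eqxx.
have {}xs : A e s y \/ A e v y.
  by case: xs => [<-|[_ /eqP<-]]; [left|right].
move: eRc xs; rewrite mem_rcons inE => /orP[/eqP->|eR xs].
  by case=> [/c_not_start[]|?] //; exists y.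
by case: (noR eR xs).
Qed.

Let R_not_to_v e : e \in R -> ~~ A e s v.
Proof.
move=> eR; have [y Acy] := c_from_v.
case=> [eyt|/(regP reg)[g [q1 [q2 [gG eg]]]]].
  by apply: (@no_to_v _ [::]) => //; [exact: (reg_subR reg)|constructor 1; rewrite -eyt].
apply: (@no_to_v _ g.2); last exact: (suffix_group gG eg).
- exact: (reg_subR reg).
- exact: (reg_notinR uU' reg).
- exact: (reg_uniq2 uU' reg).
- exact: subU.
Qed.

(** The cut around [s] alone gives an arc of [d] leaving [s]. Its head is [y], by [arc_from_start],
    or [v]; in the latter case the contracted path supplies an arc to [y] from [s] or [v]. *)
Let group_start g d y q : g \in G -> d \in g.2 -> g.1 = y :: q ->
  A d s y \/ A d s v /\ A d v y.
Proof.
move=> gG dg eg; have dU' := subU gG dg.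
have dR : d \notin R by apply/negP=> /(reg_notinR uU' reg gG); rewrite dg.
have [e [x [z [eRd Axz xs zt]]]] := cutR (sU'U dU') dR xpred0.
have {xs} exs : x = s by case: xs => // -[].
rewrite exs in Axz.
have {}zt : z = v \/ (z = t \/ z \in V').
  by case: zt => [?|[/inV'[?|?] _]]; [right; left|left|right; right].
move: eRd; rewrite mem_rcons inE => /orP[/eqP ed|eR]; last first.
  case: zt => [ez|zt]; first by have := R_not_to_v eR; rewrite -ez Axz.
  by case: (noR eR _ zt); left.
rewrite {}ed in Axz; case: zt => [ez|zt].
  rewrite ez in Axz; have := reg_path reg gG dg; rewrite eg /= => /andP[+ _].
  by rewrite /A' /contract eqxx => /orP[]; [left|right].
have [g' [q' [g'G dg' eg']]] := arc_from_start uU' reg nr' dU' (AA' Axz) zt.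
left; have := reg_disj2 uU' reg gG g'G dg dg'.
by move=> egg; move: eg'; rewrite -egg eg => -[->].
Qed.

Let group_path g d y q : g \in G -> d \in g.2 -> g.1 = y :: q ->
  path (A d) y (rcons q t).
Proof.
move=> gG dg eg; have := reg_path reg gG dg.
rewrite eg /= => /andP[_]; rewrite contract_path // -eg.
by apply: contra sV'; exact: (reg_subV reg gG).
Qed.

(** The cut has only [t] on the sink side. No colour of [R] has an arc to [t], so the crossing arc
    has colour [c], and it leaves neither [s] nor [v]. *)
Let c_to_end : ~~ A c v t -> exists2 x, A c x t & x \in V'.
Proof.
move=> ncvt; have [e [x [y [eRc Axy xs yt]]]] := cutR cU cR xpredT.
have {yt} eyt : y = t by case: yt => // -[].
rewrite {}eyt in Axy; have {}xs : [\/ x = s, x = v | x \in V'].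
  by case: xs => [->|[/inV'[->|?] _]]; [constructor 1|constructor 2|constructor 3].
move: eRc; rewrite mem_rcons inE => /orP[/eqP ec|eR].
  rewrite {}ec in Axy; case: xs => [ex|ex|xV']; last by exists x.
    by case: (@c_not_start t _ (or_introl erefl)); rewrite -ex.
  by rewrite -ex Axy in ncvt.
have ntt : t = t \/ t \in V' by left.
case: xs => [ex|ex|xV']; rewrite ?ex in Axy.
- by case: (noR eR _ ntt); left.
- by case: (noR eR _ ntt); right.
have [g [q1 [q2 [r1 [r2 [gG _ eg _]]]]]] :=
  arc_colour_R uU' reg nr' eR (AA' Axy) (or_intror xV') ntt.
by case/negP: tV'; apply: (reg_subV reg gG); rewrite eg mem_cat mem_head orbT.
Qed.

Let head_path (B : rel N) (z : N) q :
  (forall r1 x r2, z :: q = r1 ++ x :: r2 -> B x (head t r2)) ->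
  path B z (rcons q t).
Proof.
elim: q z => [|w q IH] z Bz /=; first by rewrite (Bz [::] z [::]).
rewrite (Bz [::] z (w :: q)) //=; apply: IH => r1 x r2 e.
by apply: (Bz (z :: r1)); rewrite e.
Qed.

Let perm_nodes : perm_eq (v :: flatten (map fst G)) V.
Proof.
rewrite perm_sym; apply: (perm_trans (perm_to_rem vV)).
by rewrite perm_cons perm_sym (reg_nodes reg).
Qed.

Let perm_colours : perm_eq (c :: flatten (map snd G) ++ R) U.
Proof.
rewrite perm_sym; apply: (perm_trans (perm_to_rem cU)).
by rewrite perm_cons perm_sym (reg_colours reg).
Qed.

Let c_from_group_to_end g q1 x q2 L : g \in G -> g.1 = q1 ++ x :: q2 ->
    {subset L <= g.2} -> uniq L ->
    (forall d, d \in L -> path (A d) s (rcons g.1 t)) -> size q1 < size L ->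
  ~~ A c x t.
Proof.
move=> gG eg sL uL pL sz; apply/negP=> Axt; apply: (nr (cs := L ++ [:: c])).
- by rewrite cat_uniq uL /= orbF andbT (contra (@sL c) (cG gG)).
- by move=> z; rewrite mem_cat inE => /orP[/sL/(subU gG)/sU'U|/eqP->].
- by apply: prefix eg pL sz _ => //; constructor 1.
Qed.

(** The vertex [v] becomes a path of its own with the single colour [c]. The old paths start
    directly at [s], since a colour entering [v] could be followed by [c] to [t]. *)
Let step_loop : A c v t -> exists G1, regimented A V s t U G1 R.
Proof.
move=> Avt; exists (([:: v], [:: c]) :: G); split => //=.
- move=> g; rewrite inE => /orP[/eqP->//|]; exact: (reg_size reg).
- move=> g; rewrite inE => /orP[/eqP->//|]; exact: (reg_neq0 reg).
move=> g d; rewrite inE => /orP[/eqP->|gG dg].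
  by rewrite inE => /eqP-> /=; rewrite Asv Avt.
have := reg_neq0 reg gG; case eg : g.1 => [|y q] //= _.
rewrite (group_path gG dg eg) andbT.
case: (group_start gG dg eg) => [//|[Adv _]]; suff /negP[] : ~~ A d s v by [].
by apply: (@no_to_v d [::]) => //; [exact: subU dg | constructor 1].
Qed.

(** The arc of [c] from [v] enters a group [m], and [v] and [c] are added at the front of [m]. For
    this, [y] must be the first vertex of [m], the colours of [m] must pass through [v], and [c]
    must follow the whole path of [m]. *)
Let step_insert : ~~ A c v t -> exists G1, regimented A V s t U G1 R.
Proof.
move=> ncvt; have [y Acvy [eyt|yV']] := c_from_v; first by rewrite -eyt Acvy in ncvt.
have [m [q1 [q2 [mG em]]]] := regP reg yV'.
(* Entering [v] by [d] and then [m] by [c] gives a rainbow path whenever the colours of [m] other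
   than [d] suffice for the rest. *)
have to_v d : d \in U' -> A d s v -> d \in m.2 /\ q1 = [::].
  move=> dU' Adv; have um := reg_uniq2 uU' reg mG.
  have nd : d \notin rem d m.2 by rewrite mem_rem_uniq // inE eqxx.
  have [] : d \in m.2 /\ q1 = [::] \/ size q2 < size (rem d m.2).
    rewrite size_remE -(reg_size reg mG) em size_cat /=.
    by case: (d \in m.2) (q1) => [] [|z q] /=; [left|right|right|right] => //; clear; lia.
  - by [].
  - move=> sz; suff /negP[] : ~~ A d s v by [].
    apply: (@no_to_v d (rem d m.2)) => //.
    + exact: rem_uniq.
    + by move=> z /mem_rem; exact: subU.
    + by apply: (suffix mG em) => // z /mem_rem.
(* By [to_v] these colours do not enter [v], so their paths already exist before the contraction. *)
have start_other g d : g \in G -> g != m \/ q1 <> [::] -> d \in g.2 ->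
    path (A d) s (rcons g.1 t).
  move=> gG gm dg; have := reg_neq0 reg gG; case eg : g.1 => [|z q] //= _.
  rewrite (group_path gG dg eg) andbT.
  case: (group_start gG dg eg) => [//|[/to_v[]]]; first exact: subU dg.
  move=> dm q10; case: gm => [/eqP[]|//]; exact: (reg_disj2 uU' reg gG mG dg dm).
have to_end_other g x q1' q2' : g \in G -> g != m \/ q1 <> [::] ->
    g.1 = q1' ++ x :: q2' -> ~~ A c x t.
  move=> gG gm eg; apply: (c_from_group_to_end gG eg (L := g.2)) => //.
  - exact: (reg_uniq2 uU' reg).
  - by move=> d; exact: start_other.
  - by rewrite -(reg_size reg gG) eg size_cat /=; clear; lia.
have [x Axt xV'] := c_to_end ncvt.
have [g [r1 [r2 [gG eg]]]] := regP reg xV'.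
(* Otherwise the path of the group of [x] starts at [s] itself, reaches [x] in its own colours, and
   [c] finishes it. *)
have {g gG eg} [q10 eg] : q1 = [::] /\ m.1 = r1 ++ x :: r2.
  case: (eqVneq g m) => [egm|ngm]; last first.
    by have /negP[] := to_end_other g x r1 r2 gG (or_introl ngm) eg.
  case eq1 : q1 => [|z q].
    by rewrite -egm.
  suff /negP[] : ~~ A c x t by [].
  by apply: (to_end_other g x r1 r2 gG _ eg); right; rewrite eq1.
rewrite {}q10 /= in em to_v start_other to_end_other.
have um := reg_uniq2 uU' reg mG; have szm := reg_size reg mG.
(* After a direct arc of [d] from [s] to [y], the other colours of [m] would lead on to [x], and [c]
   from there to [t]. *)
have via_v d : d \in m.2 -> A d s v /\ A d v y.
  move=> dm; case: (group_start mG dm em) => // Asy; exfalso.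
  have nd : d \notin rem d m.2 by rewrite mem_rem_uniq // inE eqxx.
  have nc : c \notin rem d m.2 by apply: contra (cG mG) => /mem_rem.
  apply: (nr (cs := d :: rem d m.2 ++ [:: c])).
  - rewrite /= mem_cat negb_or nd cat_uniq rem_uniq //= orbF andbT inE.
    rewrite (negbTE nc) andbT.
    by apply: contraNneq (cG mG) => <-.
  - move=> z; rewrite inE mem_cat inE => /or3P[/eqP->|/mem_rem|/eqP->//];
      [|move=> zm]; exact/sU'U/(subU mG).
  - constructor 2; exists y; split=> //; first exact: sV'V.
    case: r1 em eg => [|y' r1] em; rewrite em /= => -[eyx eq2].
      rewrite eyx; apply: (@rainbow_walk_path _ _ _ _ [::]) => //.
      by constructor 1.
    apply: (@rainbow_walk_path _ _ _ _ (rcons r1 x)).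
    + move=> z zr; apply/sV'V/(reg_subV reg mG).
      by rewrite em inE eq2 -cat_rcons mem_cat zr orbT.
    + move=> e /mem_rem em2; have := group_path mG em2 em.
      by rewrite eq2 -cat_rcons rcons_cat cat_path => /andP[].
    + by rewrite size_rcons size_remE dm -szm em eq2 /= size_cat /=; clear; lia.
    + by rewrite last_rcons; constructor 1.
have pathm d : d \in m.2 -> path (A d) s (rcons (v :: m.1) t).
  move=> dm; have [Adv Ady] := via_v d dm.
  by rewrite /= Adv em /= Ady; exact: (group_path mG dm em).
(* The way from [s] through [v] to [x'] costs [size a1 + 2] colours of [m], and what follows the arc
   of [c] costs [b]; the group cannot afford both. *)
have no_jump a1 x' a2 b : m.1 = a1 ++ x' :: a2 ->
    (forall L, {subset L <= m.2} -> b <= size L ->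
      rainbow_walk A V t x' (c :: L)) -> size a1 + 2 + b <= size m.1 -> False.
  move=> em1 w sz; set L1 := take (size a1 + 2) m.2.
  set L2 := drop (size a1 + 2) m.2.
  have sL1 : {subset L1 <= m.2} by move=> z /mem_take.
  have sL2 : {subset L2 <= m.2} by move=> z /mem_drop.
  apply: (nr (cs := L1 ++ c :: L2)).
  - have := um; rewrite -(cat_take_drop (size a1 + 2) m.2) -/L1 -/L2 !cat_uniq.
    case/and3P=> -> dis /= ->; rewrite negb_or dis andbT.
    by rewrite (contra (@sL1 c) (cG mG)) (contra (@sL2 c) (cG mG)).
  - move=> z; rewrite mem_cat inE => /or3P[/sL1 zm|/eqP->//|/sL2 zm];
      exact/sU'U/(subU mG).
  - apply: (@rainbow_walk_path _ _ _ _ (v :: rcons a1 x')).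
    + move=> z; rewrite inE => /orP[/eqP->//|za].
      by apply/sV'V/(reg_subV reg mG); rewrite em1 -cat_rcons mem_cat za.
    + move=> d /sL1 /pathm; rewrite em1 -cat_rcons /= => /andP[->].
      by rewrite rcons_cat cat_path => /andP[].
    + by rewrite size_takel /= ?size_rcons -?szm; move: sz; clear; lia.
    + rewrite /= last_rcons; apply: w => //.
      by rewrite size_drop -szm; move: sz; clear; lia.
have u1 := reg_uniq1 uV' reg mG.
have succ_arc r1' x' r2' : m.1 = r1' ++ x' :: r2' -> A c x' (head t r2').
  move=> {r1 x r2 Axt xV' eg} em'.
  (* The cut has only [t] and the vertices of [m] after [x'] on the sink side. All crossing arcs are
     excluded except that of colour [c] from [x'] to its successor. *)
  have [e [x [y' [eRc Axy xs yt]]]] := cutR cU cR (predC (mem r2')).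
  have r2V' z : z \in r2' -> z \in m.1 by rewrite em' mem_cat inE => ->; rewrite !orbT.
  have {}yt : y' = t \/ y' \in r2'.
    by case: yt => [->|[_]]; [left|rewrite /= negbK; right].
  have yt' : y' = t \/ y' \in V'.
    by case: yt => [->|/r2V'/(reg_subV reg mG)]; [left|right].
  have {}xs : [\/ x = s, x = v | x \in V' /\ x \notin r2'].
    case: xs => [->|[/inV'[->|xV'] xr]]; [by constructor 1|by constructor 2|].
    by constructor 3.
  move: eRc; rewrite mem_rcons inE => /orP[/eqP ec|eR]; last first.
    case: xs => [ex|ex|[xV' xr]]; rewrite ?ex in Axy.
    - by case: (noR eR _ yt'); left.
    - by case: (noR eR _ yt'); right.
    have [g [a1 [a2 [b1 [b2 [gG ea eb le]]]]]] :=
      arc_colour_R uU' reg nr' eR (AA' Axy) (or_intror xV') yt'.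
    have yg : y' \in g.1 by rewrite eb mem_cat mem_head orbT.
    case: yt => [ey|yr].
      by case/negP: tV'; rewrite -ey; exact: (reg_subV reg gG).
    have egm := reg_disj1 uV' reg gG mG yg (r2V' _ yr).
    rewrite {}egm in gG ea eb yg.
    have xm : x \in rcons r1' x'.
      have : x \in m.1 by rewrite ea mem_cat mem_head orbT.
      by rewrite em' -cat_rcons mem_cat (negbTE xr) orbF.
    have ny : y' \notin rcons r1' x'.
      have := u1; rewrite em' -cat_rcons cat_uniq => /and3P[_ /hasPn dis _].
      exact: dis yr.
    exfalso; move: le; rewrite leqNgt => /negP; apply.
    have idx q z r : m.1 = q ++ z :: r -> size q = index z m.1.
      move=> eq; have := u1; rewrite eq index_cat /= eqxx addn0 cat_uniq.
      by case/and3P=> _ /= /norP[/negbTE-> _].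
    rewrite (idx _ _ _ ea) (idx _ _ _ eb) em' -cat_rcons !index_cat xm (negbTE ny).
    by rewrite -index_mem in xm; exact: ltn_addr.
  rewrite {}ec in Axy; case: xs => [ex|ex|[xV' xr]].
  - by rewrite ex in Axy; case: (c_not_start Axy yt').
  - rewrite ex in Axy; case: yt => [ey|yr]; first by rewrite -ey Axy in ncvt.
    have [d dm] : exists d, d \in m.2.
      by case: m.2 szm => [|d l]; [rewrite em | exists d; rewrite mem_head].
    have yq : y' \in q2.
      have := r2V' _ yr; rewrite em inE => /orP[/eqP ey|//].
      have := u1; rewrite em' -cat_rcons cat_uniq => /and3P[_ /hasPn /(_ _ yr) + _].
      case: r1' em' => [|z r1'']; rewrite em ey => -[-> _];
        by rewrite /= inE eqxx.
    case/path.splitPr: yq em => b1 b2 em.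
    (* An arc of [c] from [v] that skips [y] saves a colour [d] of [m], which can then be used to
       enter [v]. *)
    have [Adv _] := via_v d dm; have dU' := subU mG dm.
    suff /negP[] : ~~ A d s v by [].
    apply: (@no_to_v d (rem d m.2)) => //.
    + by rewrite mem_rem_uniq // inE eqxx.
    + exact: rem_uniq.
    + by move=> z /mem_rem; exact: subU.
    + apply: (suffix (q1 := y :: b1) mG em) => // [z /mem_rem//|].
      by rewrite size_remE dm -szm em /= size_cat /=; clear; lia.
  - have [g [a1 [a2 [gG eg]]]] := regP reg xV'.
    have suf b1 b2 : m.1 = b1 ++ y' :: b2 -> forall L, {subset L <= m.2} ->
        (size b2).+1 <= size L -> rainbow_walk A V t x (c :: L).
      by move=> eb L sL sz; exact: (suffix mG eb).
    have end_at : y' = t -> forall L, rainbow_walk A V t x (c :: L).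
      by move=> ey L; constructor 1; rewrite -ey.
    have [egm|ngm] := eqVneq g m; last first.
      (* From another group, [x] is reached in the colours of [g] alone, and all of [m.2] is left
         for the rest. *)
      exfalso; apply: (nr (cs := g.2 ++ c :: m.2)).
      + rewrite cat_uniq (reg_uniq2 uU' reg) //= negb_or !cG // um /= andbT.
        apply/hasPn => z zm; apply: contra ngm => zg.
        by rewrite (reg_disj2 uU' reg gG mG zg zm).
      + by move=> z; rewrite mem_cat inE => /or3P[zg|/eqP->//|zg];
          apply/sU'U; [exact: (subU gG)|exact: (subU mG)].
      + apply: (prefix gG eg).
        * by move=> d; apply: start_other gG _; left.
        * by rewrite -(reg_size reg gG) eg size_cat /=; clear; lia.
        case: yt => [/end_at//|yr]; case/path.splitPr: yr em' => b1 b2 em'.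
        apply: (@suf (r1' ++ x' :: b1) b2) => //; first by rewrite em' -catA.
        by rewrite -szm em' !size_cat /= size_cat /=; clear; lia.
    have : x \in rcons r1' x'.
      have : x \in m.1 by rewrite -egm eg mem_cat mem_head orbT.
      by rewrite em' -cat_rcons mem_cat (negbTE xr) orbF.
    rewrite mem_rcons inE => /orP[/eqP exx|xr1]; last first.
      (* An arc from a vertex before [x'] skips [x'], which [no_jump] forbids. *)
      exfalso; case/path.splitPr: xr1 em' => c1 c2; rewrite -catA /= => em'.
      case: yt => [/end_at w|yr].
        apply: (no_jump c1 x (c2 ++ x' :: r2') 0 em') => [L _ _//|].
        by rewrite em' !size_cat /= size_cat /=; clear; lia.
      case/path.splitPr: yr em' => b1 b2 em'.
      apply: (no_jump c1 x (c2 ++ x' :: b1 ++ y' :: b2) (size b2).+1 em').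
        apply: (@suf (c1 ++ x :: c2 ++ x' :: b1) b2).
        by rewrite em' -!catA /= -!catA /=.
      by rewrite em' !size_cat /= !size_cat /= size_cat /=; clear; lia.
    rewrite -{}exx in em' *; case: r2' {xr r2V'} yt em' => [[<- //|//]|z r].
    rewrite inE => yt em' /=.
    have [eyz|nyz] := eqVneq y' z; first by rewrite -eyz.
    exfalso; case: yt => [/end_at w|/orP[|yr]]; last 2 first.
    - by rewrite (negbTE nyz).
    - case/path.splitPr: yr em' => b1 b2 em'.
      apply: (no_jump r1' x (z :: b1 ++ y' :: b2) (size b2).+1 em').
        by apply: (@suf (r1' ++ x :: z :: b1) b2); rewrite em' -!catA.
      by rewrite em' !size_cat /= size_cat /=; clear; lia.
    - apply: (no_jump r1' x (z :: r) 0 em') => [L _ _//|].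
      by rewrite em' !size_cat /=; clear; lia.
exists ((v :: m.1, c :: m.2) :: rem m G); split => /=.
- apply: perm_trans perm_nodes; rewrite perm_cons perm_sym.
  exact: (perm_flatten (perm_map fst (perm_to_rem mG))).
- apply: perm_trans perm_colours; rewrite perm_cons perm_cat2r perm_sym.
  exact: (perm_flatten (perm_map snd (perm_to_rem mG))).
- move=> g; rewrite inE => /orP[/eqP->/=|/mem_rem]; first by rewrite szm.
  exact: (reg_size reg).
- move=> g; rewrite inE => /orP[/eqP->//|/mem_rem]; exact: (reg_neq0 reg).
- move=> g d; rewrite inE => /orP[/eqP->/=|].
    rewrite inE => /orP[/eqP->|/pathm//]; rewrite Asv em /= Acvy /=.
    by apply: head_path => r1' x' r2' e; apply: (succ_arc r1'); rewrite em.
  rewrite mem_rem_uniq ?(reg_uniqG uV' reg) // => /andP[gm gG] dg.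
  by apply: start_other => //; left.
Qed.

Lemma regimented_step : exists G1, regimented A V s t U G1 R.
Proof. by case: (boolP (A c v t)) => [/step_loop|/step_insert]. Qed.

End RegimentedStep.

(** A cut of the contraction becomes one of the original network by putting [v] on the source
    side. *)
Lemma cut_arc_contract A V s t v K : v \in V -> uniq V ->
  cut_arc A V s t K -> cut_arc (contract A s v) (rem v V) s t K.
Proof.
move=> vV uV cutK X.
have [c [x [y [cK Axy xs yt]]]] := cutK (predU1 v X).
have yt' : y = t \/ y \in rem v V /\ ~~ X y.
  case: yt => [|[yV]]; [by left|rewrite /= negb_or => /andP[yv Xy]; right].
  by rewrite mem_rem_uniq // inE yv.
have start : A c s y \/ A c v y -> exists c x y, [/\ c \in K,
    contract A s v c x y, x = s \/ x \in rem v V /\ X x & y = t \/ y \in rem v V /\ ~~ X y].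
  move=> A'y; exists c, s, y; split=> //; last by left.
  by rewrite /contract eqxx; case: A'y => ->; rewrite ?orbT.
case: xs => [exs|[xV /predU1P[exv|Xx]]].
- by apply: start; left; rewrite -exs.
- by apply: start; right; rewrite -exv.
have [exv|nxv] := eqVneq x v; first by apply: start; right; rewrite -exv.
exists c, x, y; split; rewrite /contract ?Axy //.
by right; rewrite mem_rem_uniq // inE nxv.
Qed.

(** Each contraction removes one vertex and one colour, which preserves the balance of sizes and
    leaves [R] with [k - 1] colours throughout. *)
Theorem regimented_exists k A V s t U : uniq V -> uniq U ->
    s \notin V -> t \notin V -> (size U).+1 = size V + k ->
    (forall K, uniq K -> {subset K <= U} -> size K = k -> cut_arc A V s t K) ->
    no_rainbow A V s t U ->
  exists G R, regimented A V s t U G R /\ (size R).+1 = k.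
Proof.
move: {-1}(size V) (erefl (size V)) => n.
elim: n => [|n IH] in A V U *; move=> szV uV uU sV tV szU cuts nr.
  (* Without inner vertices there is no group, and [R] takes all [k - 1] colours. *)
  exists [::], U; split=> //; split=> //.
  by rewrite (size0nil szV).
have szk : k <= size U by move: szU => /=; clear; lia.
have sK : {subset take k U <= U} by move=> z /mem_take.
(* The cut around [s] yields the arc to contract. It does not end at [t], since a single arc would
   already be a rainbow path. *)
have [|c [x [v [cU Asv xs vt]]]] := cuts _ (take_uniq k uU) sK _ xpred0.
  by rewrite size_takel.
move/sK in cU; have {xs} exs : x = s by case: xs => // -[].
rewrite {}exs in Asv.
have vV : v \in V.
  case: vt => [evt|[]//].
  exfalso; apply: (nr [:: c]) => [//|z|]; first by rewrite inE => /eqP->.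
  by constructor 1; rewrite -evt.
have cU' : c \notin rem c U by rewrite mem_rem_uniq // inE eqxx.
have sU' : {subset rem c U <= U} by exact: mem_rem.
have sV' : {subset rem v V <= V} by exact: mem_rem.
have [] := IH (contract A s v) (rem v V) (rem c U).
- by rewrite size_rem // szV.
- exact: rem_uniq.
- exact: rem_uniq.
- by apply: contra sV => /sV'.
- by apply: contra tV => /sV'.
- rewrite size_rem // prednK; last by case: (U) cU.
  by move: szU => /=; clear; lia.
- by move=> K uK sKU' szK; apply: cut_arc_contract => //; apply: cuts => // z /sKU'/sU'.
- move=> cs ucs scs w.
  have [|/(rainbow_walk_sub sV')|/(rainbow_walk_sub sV')] := contract_walk_start _ w.
  + by apply: contra sV => /sV'.
  + by apply: nr => // z /scs/sU'.
  + move=> {}w; apply: (nr (c :: cs)) => [|z|].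
    * by rewrite /= ucs andbT (contra (@scs c)).
    * by rewrite inE => /orP[/eqP->//|/scs/sU'].
    * by constructor 2; exists v.
move=> G [R [reg szR]].
by have [G1 reg1] := regimented_step uV uU sV tV cuts nr cU vV Asv reg szR; exists G1, R.
Qed.

End Networks.

(** * Alternating arcs of a rainbow matching *)

Section RainbowMatchings.
Variables (C : finType) (T : eqType) (E : C -> rel T).
Implicit Types (M : seq (C * (T * T))) (x y : option (T * T)).

Definition lefts M := unzip1 (unzip2 M).
Definition rights M := unzip2 (unzip2 M).

(** An entry is a colour with an edge oriented from left to right. Both sides share the type [T],
    and one element may stand for a left and for a right vertex. *)
Definition rmatching M :=
  [&& uniq (unzip1 M), uniq (lefts M), uniq (rights M) &
      all (fun e => E e.1 e.2.1 e.2.2) M].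

(* [None] is both source and sink: as the tail of an arc it stands for any
   left vertex outside [lv], as its head for any right vertex outside [rv]. *)
Definition tail_at (lv : seq T) x a := if x is Some e then a == e.1 else a \notin lv.
Definition head_at (rv : seq T) y b := if y is Some e then b == e.2 else b \notin rv.

(** An alternating path enters an edge of the matching at its right end and leaves it at its left
    end. With matching edges contracted to vertices, the edges of colour [c] become arcs, and a
    matching edge contained in [c] becomes a loop. *)
Definition alt_arc lv rv c x y : bool :=
  `[< exists a b, [/\ tail_at lv x a, head_at rv y b & E c a b] >].

Definition nodes M := map Some (unzip2 M).

Lemma alt_arcSS lv rv c e f : alt_arc lv rv c (Some e) (Some f) = E c e.1 f.2.
Proof.
apply/asboolP/idP => [[a [b [/eqP-> /eqP->]]] //|Eef].
by exists e.1, f.2; rewrite /= !eqxx.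
Qed.

Lemma eq_alt_arc lv lv' rv rv' : lv =i lv' -> rv =i rv' ->
  alt_arc lv rv = alt_arc lv' rv'.
Proof.
move=> el er; apply/funext => c; apply/funext => x; apply/funext => y.
have etl a : tail_at lv x a = tail_at lv' x a by case: x => //=; rewrite el.
have ehd b : head_at rv y b = head_at rv' y b by case: y => //=; rewrite er.
by apply/asboolP/asboolP => -[a [b [? ? ?]]]; exists a, b; split=> //;
  rewrite ?etl ?ehd // -?etl -?ehd.
Qed.

Lemma rmatching_perm M M' : perm_eq M M' -> rmatching M = rmatching M'.
Proof.
move=> p; rewrite /rmatching /lefts /rights (perm_all _ p).
rewrite (perm_uniq (perm_map fst p)) (perm_uniq (perm_map fst (perm_map snd p))).
by rewrite (perm_uniq (perm_map snd (perm_map snd p))).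
Qed.

Lemma rmatching_cons c e M : rmatching ((c, e) :: M) =
  [&& c \notin unzip1 M, e.1 \notin lefts M, e.2 \notin rights M, E c e.1 e.2
    & rmatching M].
Proof.
rewrite /rmatching /=.
by do ![case: (_ \notin _) => //=|case: (uniq _) => //=]; rewrite ?andbF.
Qed.

Lemma uniq_pairs M : rmatching M -> uniq (unzip2 M).
Proof. by case/and4P=> _ /map_uniq. Qed.

Lemma nodes_uniq M : rmatching M -> uniq (nodes M).
Proof. by move=> /uniq_pairs u; rewrite map_inj_uniq // => ? ? []. Qed.

Lemma nodesP M x : x \in nodes M -> exists2 e, x = Some e & exists c, (c, e) \in M.
Proof.
by case/mapP=> e /mapP[[c e'] eM /= ->] ->; exists e' => //; exists c.
Qed.

Lemma mem_nodes M e : (Some e \in nodes M) = (e \in unzip2 M).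
Proof. by rewrite mem_map // => ? ? []. Qed.

Lemma None_nodes M : None \notin nodes M.
Proof. by apply/negP=> /nodesP[]. Qed.

Lemma replace_rmatching M c e d f : rmatching M -> (c, e) \in M ->
    d \notin unzip1 M -> E d f.1 f.2 -> f.1 = e.1 \/ f.1 \notin lefts M ->
    f.2 = e.2 -> rmatching ((d, f) :: rem (c, e) M).
Proof.
move=> rM eM; have p := perm_to_rem eM; move: rM; rewrite (rmatching_perm p).
rewrite !rmatching_cons => /and5P[nc n1 n2 _ rM'] nd Edf f1 f2.
rewrite rM' Edf f2 n2 /=.
move: nd f1; rewrite (perm_mem (perm_map _ p)) /= inE negb_or => /andP[_ ->].
rewrite (perm_mem (perm_map _ (perm_map _ p))) /= inE negb_or.
by case=> [->|/andP[_ ->]]; rewrite ?n1.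
Qed.

(** The left end of [e] is free, so for an arc from [e] to [f] the edge from [e.1] to [f.2] can
    replace [f], whose left end becomes free in turn. The covered right ends do not change before
    the last arc. By [rainbow_walk_avoid] the rest of the walk need not return to [f], which has
    left the matching. *)
Lemma augment_from cs : forall M e lv rv (V : seq (option (T * T))),
    rmatching M -> {subset V <= nodes M} -> e.1 \notin lefts M ->
    rv =i rights M -> uniq cs -> {in cs, forall c, c \notin unzip1 M} ->
    rainbow_walk (alt_arc lv rv) V None (Some e) cs ->
  exists2 M', rmatching M' & size M' = (size M).+1.
Proof.
elim: cs => //= c cs IH M e lv rv V rM sV ne erv /andP[ccs ucs] ncs.
have nc := ncs _ (mem_head _ _).
have ncs' : {in cs, forall d, d \notin unzip1 M}.
  by move=> d dcs; apply: ncs; rewrite inE dcs orbT.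
case=> [/asboolP[a [b [/eqP-> /= nb Eab]]]|[y [yV]]|]; last exact: IH ucs ncs'.
  exists ((c, (e.1, b)) :: M) => //.
  by rewrite rmatching_cons nc /= ne rM Eab -erv nb.
have [f ey [cf fM]] := nodesP (sV _ yV).
rewrite ey alt_arcSS => Eef w.
have {}w : rainbow_walk (alt_arc lv rv) (filter (predC1 (Some f)) V) None (Some f) cs.
  by case: (rainbow_walk_avoid (Some f) w).
have rM1 : rmatching ((c, (e.1, f.2)) :: rem (cf, f) M).
  by apply: replace_rmatching => //; right.
have p := perm_to_rem fM.
have [||||M' rM' szM'] := IH _ f lv rv _ rM1 _ _ _ ucs _ w.
- move=> z; rewrite mem_filter => /andP[/= nz /sV].
  rewrite (perm_mem (perm_map _ (perm_map _ p))) /= inE (negbTE nz) /= => zr.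
  by rewrite inE zr orbT.
- rewrite /= inE negb_or.
  have := rM; rewrite (rmatching_perm p) rmatching_cons => /and5P[_ -> _ _ _].
  rewrite andbT /=; apply: contraNneq ne => <-.
  by apply/mapP; exists f => //; apply/mapP; exists (cf, f).
- by move=> z; rewrite erv (perm_mem (perm_map _ (perm_map _ p))).
- move=> d dcs; rewrite /= inE negb_or; apply/andP; split.
    by apply: contraNneq ccs => <-.
  by apply: contra (ncs' _ dcs) => /mapP[z /mem_rem zM ->]; exact: map_f.
- by exists M' => //; rewrite szM' /= size_rem // prednK //; case: (M) fM.
Qed.

(** Arcs refer to a matching [M0] covering the same vertices, so that a walk found for one matching
    can augment another obtained from it by a switch. The first arc used fixes a free left vertex,
    which then plays the role of [e.1] in [augment_from]. *)
Lemma augment M M0 V cs : rmatching M -> {subset V <= nodes M} ->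
    lefts M0 =i lefts M -> rights M0 =i rights M ->
    uniq cs -> {in cs, forall c, c \notin unzip1 M} ->
    rainbow_walk (alt_arc (lefts M0) (rights M0)) V None None cs ->
  exists2 M', rmatching M' & size M' = (size M).+1.
Proof.
move=> rM sV el er; elim: cs => //= c cs IH /andP[ccs ucs] ncs w.
have {w} : rainbow_walk (alt_arc (lefts M0) (rights M0)) V None None cs \/
    exists2 e : T * T, e.1 \notin lefts M &
      rainbow_walk (alt_arc (lefts M0) (rights M0)) V None (Some e) (c :: cs).
  case: w => [/asboolP[a [b [na hb Eab]]]|[y [yV /asboolP[a [b [na hb Eab]]] w]]|w];
    [right|right|by left]; exists (a, b); rewrite /= -?el //.
    by constructor 1; apply/asboolP; exists a, b; split=> /=.
  by constructor 2; exists y; split=> //; apply/asboolP; exists a, b; split=> /=.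
case=> [|[e ne w]].
  by apply: IH ucs _ => d dcs; apply: ncs; rewrite inE dcs orbT.
by apply: (augment_from rM sV ne er _ ncs w); rewrite /= ccs.
Qed.

Lemma swap_colour M c e d : rmatching M -> (c, e) \in M -> d \notin unzip1 M ->
    E d e.1 e.2 ->
  exists M', [/\ rmatching M', size M' = size M, unzip2 M' =i unzip2 M
    & forall z, z \in unzip1 M' -> z = d \/ z \in unzip1 M /\ z != c].
Proof.
move=> rM eM nd Ed; have p := perm_to_rem eM.
exists ((d, e) :: rem (c, e) M); split.
- by apply: (replace_rmatching rM eM nd Ed) => //; left.
- by rewrite (perm_size p).
- by move=> z; rewrite (perm_mem (perm_map snd p)).
move=> z; rewrite inE => /orP[/eqP->|zr]; [by left|right].
rewrite (perm_mem (perm_map fst p)) /= inE zr orbT; split=> //.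
have := rM; rewrite (rmatching_perm p) rmatching_cons => /and5P[nc _ _ _ _].
by apply: contraNneq nc => ezc; move: zr; rewrite ezc.
Qed.

Lemma eq_lefts M M' : unzip2 M' =i unzip2 M -> lefts M' =i lefts M.
Proof. by move=> h; apply: eq_mem_map. Qed.

Lemma eq_rights M M' : unzip2 M' =i unzip2 M -> rights M' =i rights M.
Proof. by move=> h; apply: eq_mem_map. Qed.

End RainbowMatchings.

(** * Switching along an alternating cycle *)

Section Rotation.
Variables (C : finType) (T : eqType) (E : C -> rel T).
Implicit Types (M : seq (C * (T * T))).

(* Switches along the alternating cycle through the edges f :: B of M, whose
   other edges are the chord closing the block and those coloured by D. *)
Lemma rotate_block M f (B : seq (T * T)) u (D : seq C) : rmatching E M ->
    {subset f :: B <= unzip2 M} -> uniq (f :: B) -> E u (last f B).1 f.2 ->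
    size D = size B ->
    (forall d, d \in D -> path (fun a b => E d a.1 b.2) f B) ->
    uniq (u :: D) -> {in u :: D, forall c, c \notin unzip1 M} ->
  exists M', [/\ rmatching E M', size M' = size M,
      lefts M' =i lefts M /\ rights M' =i rights M,
      {subset [seq e <- unzip2 M | e \notin f :: B] <= unzip2 M'} /\
        ((last f B).1, f.2) \in unzip2 M'
    & forall c, c \in unzip1 M' -> c \in u :: D \/
        exists2 e, (c, e) \in M & e \notin f :: B].
Proof.
move=> rM sB uB Euf szD pB uD nD.
set inB := [pred z : C * (T * T) | z.2 \in f :: B].
set M0 := filter (predC inB) M.
(* Each left end in the block is joined to the right end of the next edge, and the last one to that
   of [f]; the covered vertices stay the same. *)
pose new := ((last f B).1, f.2) :: zip (unzip1 (belast f B)) (unzip2 B).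
pose M' := zip (u :: D) new ++ M0.
have pM : perm_eq (unzip2 M) (f :: B ++ unzip2 M0).
  have -> : f :: B ++ unzip2 M0 = (f :: B) ++ unzip2 M0 by [].
  apply: (@perm_trans _ (unzip2 (filter inB M) ++ unzip2 M0)).
    by rewrite -map_cat perm_sym; apply: perm_map; rewrite perm_filterC.
  rewrite perm_cat2r; apply: uniq_perm => //.
    apply: (@subseq_uniq _ _ (unzip2 M)); last exact: uniq_pairs rM.
    exact: (map_subseq _ (filter_subseq _ _)).
  move=> e; apply/mapP/idP => [[z + ->]|eB]; first by rewrite mem_filter => /andP[].
  by have /mapP[z zM ez] := sB _ eB; exists z; rewrite // mem_filter /= -ez eB.
have szn : size (u :: D) = size new.
  by rewrite /= size_zip !size_map size_belast szD minnn.
have zn1 : unzip1 (zip (u :: D) new) = u :: D by rewrite unzip1_zip // szn.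
have zn2 : unzip2 (zip (u :: D) new) = new by rewrite unzip2_zip // szn.
have ln : perm_eq (unzip1 new) (unzip1 (f :: B)).
  have -> : unzip1 new = (last f B).1 :: unzip1 (belast f B).
    by rewrite /= unzip1_zip // !size_map size_belast.
  by rewrite perm_sym lastI /unzip1 map_rcons perm_rcons.
have rn : unzip2 new = unzip2 (f :: B).
  by rewrite /= unzip2_zip // !size_map size_belast.
have eM1 : unzip1 M' = (u :: D) ++ unzip1 M0.
  by rewrite -zn1 /M'; exact: map_cat.
have eM' : unzip2 M' = new ++ unzip2 M0 by rewrite -zn2 /M'; exact: map_cat.
have pl : perm_eq (lefts M') (lefts M).
  rewrite perm_sym; apply: (perm_trans (perm_map fst pM)).
  have -> : lefts M' = unzip1 new ++ lefts M0 by rewrite /lefts eM'; exact: map_cat.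
  by rewrite -cat_cons (map_cat fst (f :: B)) perm_cat2r perm_sym.
have pr : perm_eq (rights M') (rights M).
  rewrite perm_sym; apply: (perm_trans (perm_map snd pM)).
  have -> : rights M' = unzip2 new ++ rights M0 by rewrite /rights eM'; exact: map_cat.
  by rewrite -cat_cons (map_cat snd (f :: B)) rn.
have cM0 : {subset unzip1 M0 <= unzip1 M}.
  by move=> c /mapP[z + ->]; rewrite mem_filter => /andP[_ zM]; exact: map_f.
exists M'; split.
- apply/and4P; split.
  + rewrite eM1 cat_uniq uD /=; apply/andP; split.
      by apply/hasPn => c /cM0 cM; apply: contraL cM; exact: nD.
    apply: (@subseq_uniq _ _ (unzip1 M)); last by case/and4P: rM.
    exact: (map_subseq _ (filter_subseq _ _)).
  + by rewrite (perm_uniq pl); case/and4P: rM.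
  + by rewrite (perm_uniq pr); case/and4P: rM.
  + rewrite /M' all_cat; apply/andP; split; last first.
      rewrite all_filter; case/and4P: rM => _ _ _; apply: sub_all => z /= ->.
      by rewrite implybT.
    rewrite /= Euf /=; elim: (B) (D) (f) szD pB => [|b B' IH] [|d D'] a //= [szD] pB.
    have /andP[-> _] := pB d (mem_head _ _); apply: IH => // d' d'D.
    by have /andP[] := pB d' (mem_behead (s := d :: D') d'D).
- have := perm_size pl; rewrite !size_map; exact.
- by split; exact: perm_mem.
- split; last by rewrite eM' mem_cat mem_head.
  move=> e; rewrite mem_filter => /andP[eB /mapP[z zM ez]].
  rewrite eM' mem_cat; apply/orP; right; apply/mapP; exists z => //.
  by rewrite mem_filter /= -ez eB.
- move=> c; rewrite eM1 mem_cat => /orP[|/mapP[[c' e]]]; first by left.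
  by rewrite mem_filter => /andP[/= eB eM] ->; right; exists e.
Qed.

End Rotation.

(** * Families without a rainbow matching of size n *)

Section Extremal.
Variables (C : finType) (T : eqType) (E : C -> rel T) (n k : nat).
Hypotheses (k_gt1 : 1 < k) (kn : k <= n) (cardC : #|C| = 2 * n + k - 3).
Hypothesis E_neq0 : forall c, exists a b, E c a b.
(** The easy half of Koenig's theorem: fewer than [n] vertices cannot cover a matching of size
    [n]. *)
Hypothesis koenig : forall K : seq C, uniq K -> size K = k ->
  forall LA LB : seq T, size LA + size LB < n ->
  exists c a b, [/\ c \in K, E c a b, a \notin LA & b \notin LB].
Implicit Types (M : seq (C * (T * T))).

Definition arcs M := alt_arc E (lefts M) (rights M).
Definition unused M := [seq c <- enum C | c \notin unzip1 M].

Lemma mem_unused M c : (c \in unused M) = (c \notin unzip1 M).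
Proof. by rewrite mem_filter mem_enum andbT. Qed.

Lemma unused_uniq M : uniq (unused M).
Proof. by rewrite filter_uniq // enum_uniq. Qed.

Lemma uniq_map_inj (S1 S2 : eqType) (f : S1 -> S2) (l : seq S1) x y :
  uniq (map f l) -> x \in l -> y \in l -> f x = f y -> x = y.
Proof.
elim: l => //= z l IH /andP[zl ul]; rewrite !inE.
case/orP=> [/eqP->|xl] /orP[/eqP->|yl] e //; last exact: IH.
- by case/negP: zl; rewrite e map_f.
- by case/negP: zl; rewrite -e map_f.
Qed.

Lemma size_filter_notin (S : eqType) (l r : seq S) : uniq l -> uniq r ->
  {subset r <= l} -> size [seq z <- l | z \notin r] + size r = size l.
Proof.
move=> ul ur sr; have -> : size r = count [in r] l.
  rewrite -size_filter; apply/perm_size/uniq_perm; rewrite ?filter_uniq //.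
  by move=> c; rewrite mem_filter; case: (boolP (c \in r)) => // /sr->.
by rewrite addnC size_filter count_predC.
Qed.

Lemma size_unused M : rmatching E M -> size (unused M) + size M = #|C|.
Proof.
case/and4P=> uc _ _ _; rewrite -(size_map fst M) cardE.
by apply: size_filter_notin; rewrite ?enum_uniq // => c _; rewrite mem_enum.
Qed.

Lemma edge_arc M c a b : E c a b -> exists x y,
  [/\ arcs M c x y, tail_at (lefts M) x a, head_at (rights M) y b,
      x = None \/ x \in nodes M & y = None \/ y \in nodes M].
Proof.
move=> Eab.
have [x xa xs] : exists2 x, tail_at (lefts M) x a & x = None \/ x \in nodes M.
  have [/mapP[e eM ea]|na] := boolP (a \in lefts M); last by exists None; [|left].
  by exists (Some e); rewrite /= ?ea //; right; rewrite mem_nodes.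
have [y yb ys] : exists2 y, head_at (rights M) y b & y = None \/ y \in nodes M.
  have [/mapP[e eM eb]|nb] := boolP (b \in rights M); last by exists None; [|left].
  by exists (Some e); rewrite /= ?eb //; right; rewrite mem_nodes.
by exists x, y; split=> //; apply/asboolP; exists a, b.
Qed.

Lemma koenig_arc M K (Y1 Y2 : seq (T * T)) : uniq K -> size K = k ->
    size Y1 + size Y2 < n ->
  exists c x y, [/\ c \in K, arcs M c x y,
    x = None \/ exists e, [/\ x = Some e, e \in unzip2 M & e \notin Y1]
    & y = None \/ exists e, [/\ y = Some e, e \in unzip2 M & e \notin Y2]].
Proof.
move=> uK szK szY.
have [|c [a [b [cK Eab na nb]]]] := koenig uK szK (LA := unzip1 Y1) (LB := unzip2 Y2).
  by rewrite !size_map.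
have [x [y [Axy xa yb xs ys]]] := edge_arc M Eab.
exists c, x, y; split=> //.
- case: xs => [|/mapP[e eM ex]]; [by left|right; exists e; split=> //].
  by apply: contra na => eY; move: xa; rewrite ex /= => /eqP->; exact: map_f.
- case: ys => [|/mapP[e eM ey]]; [by left|right; exists e; split=> //].
  by apply: contra nb => eY; move: yb; rewrite ey /= => /eqP->; exact: map_f.
Qed.

(** Take the right end of each edge of [M] on the source side and the left end of every other one.
    These are fewer than [n] vertices, and an edge avoiding them crosses the cut. *)
Lemma cut_arcs M K : size M < n -> uniq K -> size K = k ->
  cut_arc (arcs M) (nodes M) None None K.
Proof.
move=> szM uK szK X.
pose Y1 := [seq e <- unzip2 M | ~~ X (Some e)].
pose Y2 := [seq e <- unzip2 M | X (Some e)].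
have [|c [x [y [cK Axy xs ys]]]] := @koenig_arc M K Y1 Y2 uK szK.
  by rewrite addnC !size_filter (count_predC (fun e => X (Some e))) size_map.
exists c, x, y; split=> //.
- case: xs => [|[e [-> eM eY]]]; [by left|right].
  by rewrite mem_nodes; split=> //; move: eY; rewrite mem_filter eM andbT negbK.
- case: ys => [|[e [-> eM eY]]]; [by left|right].
  by rewrite mem_nodes; split=> //; move: eY; rewrite mem_filter eM andbT.
Qed.

Lemma start_walk_uniq (A : C -> rel (option (T * T))) V U G R e :
    uniq V -> uniq U -> regimented A V None None U G R ->
    no_rainbow A V None None U -> e \notin U ->
    cut_arc A V None None (rcons R e) ->
  exists cs, [/\ uniq cs, {subset cs <= e :: U} & rainbow_walk A V None None cs].
Proof.
move=> uV uU reg nr eU /(start_arc uU reg nr)[y Ay ys].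
have [L w eL] := start_walk reg Ay ys; exists (e :: L).
case: eL => [->|[g [gG _ ->]]] in w *.
  by split=> // z; rewrite !inE => ->.
split=> //=; first by rewrite (reg_uniq2 uU reg) // andbT (contra (reg_subU reg gG (x := e))).
by move=> z; rewrite !inE => /orP[->//|/(reg_subU reg gG)->]; rewrite orbT.
Qed.

(** Below size [n - 1] there is a colour to spare outside a regimented network; added to [R], it
    gives an arc out of the source that a group completes to a rainbow path. *)
Lemma grow M : rmatching E M -> (size M).+1 < n ->
  exists2 M', rmatching E M' & size M' = (size M).+1.
Proof.
move=> rM szM; apply: contrapT => no.
have nr U : {subset U <= unused M} -> no_rainbow (arcs M) (nodes M) None None U.
  move=> sU cs ucs scs w; apply: no; apply: (augment rM _ _ _ ucs _ w) => //.
  by move=> c /scs/sU; rewrite mem_unused.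
have szU := size_unused rM.
(* [m] is the number of colours required by [regimented_exists]. The strict inequality amounts to
   [size M < n - 1]. *)
pose m := size M + k.-1; have mU : m < size (unused M).
  by move: szU szM k_gt1 kn cardC; rewrite /m; clear; lia.
have uU := unused_uniq M.
have sU : {subset take m (unused M) <= unused M} by move=> z /mem_take.
have cuts K : uniq K -> size K = k -> cut_arc (arcs M) (nodes M) None None K.
  by apply: cut_arcs; exact: ltnW.
have [|||G [R [reg szR]]] := @regimented_exists C _ k (arcs M) (nodes M) None None
  (take m (unused M)) (nodes_uniq rM) (take_uniq _ uU) (None_nodes _) (None_nodes _).
- by rewrite size_takel ?(ltnW mU) // !size_map /m; move: k_gt1; clear; lia.
- by move=> K uK _; exact: cuts.
- exact: nr.
case e_drop : (drop m (unused M)) => [|e l].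
  by move: mU; rewrite -subn_gt0 -size_drop e_drop.
have eU : e \in unused M by apply: (@mem_drop m); rewrite e_drop mem_head.
have neU : e \notin take m (unused M).
  have := uU; rewrite -{1}(cat_take_drop m (unused M)) e_drop cat_uniq.
  by case/and3P=> _ /= /norP[].
have [|cs [ucs scs w]] := start_walk_uniq (nodes_uniq rM) (take_uniq _ uU) reg (nr _ sU) neU.
  apply: cuts; rewrite ?size_rcons // rcons_uniq (reg_uniqR (take_uniq _ uU) reg) andbT.
  by apply: contra neU; exact: (reg_subR reg).
apply: (nr (unused M)) w => // z /scs; rewrite inE => /orP[/eqP->//|/sU//].
Qed.

Lemma rmatching_pred : exists2 M, rmatching E M & size M = n.-1.
Proof.
suff h m : m < n -> exists2 M, rmatching E M & size M = m.
  by apply: h; move: k_gt1 kn; clear; lia.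
elim: m => [|m IH] mn; first by exists [::].
have [M rM szM] := IH (ltnW mn).
have [|M' rM' szM'] := grow rM; first by rewrite szM.
by exists M'; rewrite // szM' szM.
Qed.

Hypothesis no_rmatching : forall M, rmatching E M -> size M <> n.

Lemma no_augment M M' V cs : rmatching E M' -> size M' = n.-1 ->
    lefts M' =i lefts M -> rights M' =i rights M -> {subset V <= nodes M'} ->
    uniq cs -> {in cs, forall c, c \notin unzip1 M'} ->
  ~ rainbow_walk (arcs M) V None None cs.
Proof.
move=> rM' szM' el er sV ucs ncs w.
have [z|z|M1 rM1 szM1] := augment rM' sV _ _ ucs ncs w; rewrite ?el ?er //.
apply: (no_rmatching rM1); rewrite szM1 szM' prednK //.
by move: k_gt1 kn; clear; lia.
Qed.

Definition extremal M G R :=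
  [/\ rmatching E M, size M = n.-1,
      regimented (arcs M) (nodes M) None None (unused M) G R & (size R).+1 = k].

Lemma extremal_exists M : rmatching E M -> size M = n.-1 ->
  exists G R, extremal M G R.
Proof.
move=> rM szM.
have [|||G [R [reg szR]]] := @regimented_exists C _ k (arcs M) (nodes M) None None
  (unused M) (nodes_uniq rM) (unused_uniq M) (None_nodes _) (None_nodes _).
- have := size_unused rM; rewrite cardC !size_map szM.
  by move: k_gt1 kn; clear; lia.
- move=> K uK _; apply: cut_arcs => //; rewrite szM.
  by move: k_gt1 kn; clear; lia.
- move=> cs ucs scs; apply: (no_augment rM szM) => //.
  by move=> c /scs; rewrite mem_unused.
by exists G, R.
Qed.

Lemma nodes_map_Some M (q : seq (option (T * T))) : {subset q <= nodes M} ->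
  exists h, q = map Some h.
Proof.
elim: q => [|x q IH] sq; first by exists [::].
have [e -> _] := nodesP (sq x (mem_head _ _)).
have [h ->] := IH (fun z zq => sq z (mem_behead (s := x :: q) zq)).
by exists (e :: h).
Qed.

Lemma split_before (S : eqType) (q1 q2 r1 r2 : seq S) (x y : S) :
  q1 ++ x :: q2 = r1 ++ y :: r2 -> size r1 <= size q1 ->
  x = y \/ exists b, q1 = r1 ++ y :: b.
Proof.
elim: r1 q1 => [|z r1 IH] [|w q1] //=; [by case; left| |].
  by case=> -> _ _; right; exists q1.
rewrite ltnS => -[-> e] /(IH _ e)[]; [by left|by case=> b ->; right; exists b].
Qed.

Lemma index_split (S : eqType) (l q r : seq S) z : uniq l -> l = q ++ z :: r ->
  index z l = size q.
Proof.
move=> ul e; move: ul; rewrite e index_cat /= eqxx addn0 cat_uniq.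
by case/and3P=> _ /= /norP[/negbTE->].
Qed.

(** * Back arcs, switches and the uniqueness of the group *)

Section ExtremalTheory.
Variables (M : seq (C * (T * T))) (G : seq (seq (option (T * T)) * seq C)) (R : seq C).
Hypothesis ext : extremal M G R.

Let rM : rmatching E M. Proof. by case: ext. Qed.
Let szM : size M = n.-1. Proof. by case: ext. Qed.
Let reg : regimented (arcs M) (nodes M) None None (unused M) G R.
Proof. by case: ext. Qed.
Let szR : (size R).+1 = k. Proof. by case: ext. Qed.
Let uV := nodes_uniq rM.
Let uU := unused_uniq M.
Let ltMn : size M < n.
Proof. by rewrite szM; move: k_gt1 kn; clear; lia. Qed.

Let nr : no_rainbow (arcs M) (nodes M) None None (unused M).
Proof.
move=> cs ucs scs; apply: (no_augment rM szM) => //.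
by move=> c /scs; rewrite mem_unused.
Qed.

Let cut_rcons c : c \notin R -> cut_arc (arcs M) (nodes M) None None (rcons R c).
Proof.
by move=> cR; apply: cut_arcs; rewrite ?rcons_uniq ?cR ?(reg_uniqR uU reg) ?size_rcons.
Qed.

Let used_notinR c : c \in unzip1 M -> c \notin R.
Proof. by apply: contraL => /(reg_subR reg); rewrite mem_unused. Qed.

Let used_notin_group c g : g \in G -> c \in unzip1 M -> c \notin g.2.
Proof.
by move=> gG; apply: contraL => /(reg_subU reg gG); rewrite mem_unused.
Qed.

(* If the loop at e is available in an unused colour d, recolouring e with d
   frees its old colour c, which then joins the group of d. *)
Lemma freed_colour c e d : (c, e) \in M -> d \in unused M -> E d e.1 e.2 ->
  exists y g, [/\ arcs M c None y, g \in G, y \in g.1 & d \in g.2].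
Proof.
move=> eM dU Ed; have cM : c \in unzip1 M by apply/mapP; exists (c, e).
have dM : d \notin unzip1 M by rewrite -mem_unused.
have [M' [rM' szM' pM' cM']] := swap_colour rM eM dM Ed.
have [y Ay ys] := start_arc uU reg nr (cut_rcons (used_notinR cM)).
have [L w eL] := start_walk reg Ay ys.
have sU z : z \in unused M -> z != d -> z \notin unzip1 M'.
  rewrite mem_unused => zM zd; apply/negP=> /cM'[/eqP|[]]; first by rewrite (negbTE zd).
  by rewrite (negbTE zM).
have bad : c \notin L -> uniq L -> {subset L <= unused M} -> d \notin L -> False.
  move=> cL uL sL dL; apply: (no_augment (M := M) (V := nodes M) (cs := c :: L) rM') w.
  - by rewrite szM'.
  - exact: eq_lefts.
  - exact: eq_rights.
  - by move=> z /mapP[f fM ->]; rewrite mem_nodes pM'.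
  - by rewrite /= cL.
  - move=> z; rewrite inE => /orP[/eqP->|zL]; last first.
      by apply: sU (sL _ zL) _; apply: contraNneq dL => <-.
    apply/negP=> /cM'[ecd|[_ /eqP//]].
    by move: dM; rewrite -ecd cM.
case: eL => [eL|[g [gG yg eL]]]; first by case: bad; rewrite eL.
exists y, g; split=> //; apply: contraT => dg; case: bad; rewrite eL //.
- exact: used_notin_group.
- exact: (reg_uniq2 uU reg).
- exact: (reg_subU reg).
Qed.

(** By [freed_colour] such a loop would put [u] into a group. *)
Lemma no_loop_R u c e : u \in R -> (c, e) \in M -> ~~ E u e.1 e.2.
Proof.
move=> uR eM; apply/negP=> /(freed_colour eM (reg_subR reg uR))[y [g [_ gG _]]].
by apply/negP; exact: (reg_notinR uU reg).
Qed.

(** As [k > 1], there is a colour in [R], and it has an edge. The corresponding arc stays within one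
    path without advancing, and it is not a loop. *)
Lemma back_arc : exists u g q1 f B q2, [/\ u \in R, g \in G,
  g.1 = q1 ++ map Some (f :: B) ++ q2, B <> [::] & E u (last f B).1 f.2].
Proof.
have [u uR] : exists u, u \in R.
  case: R szR => [k1|u R' _]; last by exists u; rewrite mem_head.
  by move: k_gt1; rewrite -k1.
have [a [b Eab]] := E_neq0 u; have [x [y [Axy _ _ xs ys]]] := edge_arc M Eab.
have [g [q1 [q2 [r1 [r2 [gG eq er le]]]]]] := arc_colour_R uU reg nr uR Axy xs ys.
have gV := reg_subV reg gG.
have [f ey [c fM]] : exists2 f, y = Some f & exists c, (c, f) \in M.
  by apply: nodesP; apply: gV; rewrite er mem_cat mem_head orbT.
have [e ex _] : exists2 e, x = Some e & exists c, (c, e) \in M.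
  by apply: nodesP; apply: gV; rewrite eq mem_cat mem_head orbT.
move: Axy; rewrite ex ey /arcs alt_arcSS => Eef.
have [exy|[b' eb]] := split_before (etrans (esym eq) er) le.
  move: exy Eef; rewrite ex ey => -[->] Eff.
  by have := no_loop_R uR fM; rewrite Eff.
have [h eh] : exists h, b' = map Some h.
  apply: (@nodes_map_Some M) => z zb; apply: gV.
  by rewrite eq eb mem_cat mem_cat inE zb !orbT.
exists u, g, r1, f, (rcons h e), q2; split=> //.
- by rewrite eq eb eh ey ex -catA /= map_rcons cat_rcons.
- by case: (h).
- by rewrite last_rcons.
Qed.

Let block_sub g q1 f B q2 : g \in G -> g.1 = q1 ++ map Some (f :: B) ++ q2 ->
  {subset f :: B <= unzip2 M}.
Proof.
move=> gG eg e eB; rewrite -mem_nodes; apply: (reg_subV reg gG).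
by rewrite eg !mem_cat map_f ?orbT.
Qed.

Let block_uniq g q1 f B q2 : g \in G -> g.1 = q1 ++ map Some (f :: B) ++ q2 ->
  uniq (f :: B).
Proof.
move=> gG eg; have := reg_uniq1 uV reg gG; rewrite eg cat_uniq cat_uniq.
by case/and3P=> _ _ /and3P[/map_uniq].
Qed.

(** Apart from the chord of colour [u], the cycle takes its colours from the front of [g.2]; the
    other colours of [g] remain free. *)
Lemma rotation u g q1 f B q2 : u \in R -> g \in G ->
    g.1 = q1 ++ map Some (f :: B) ++ q2 -> E u (last f B).1 f.2 ->
  exists M', [/\ rmatching E M', size M' = n.-1,
      lefts M' =i lefts M /\ rights M' =i rights M,
      {subset [seq e <- unzip2 M | e \notin f :: B] <= unzip2 M'} /\
        ((last f B).1, f.2) \in unzip2 M'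
    & forall c, c \in unzip1 M' -> c \in u :: take (size B) g.2 \/
        exists2 e, (c, e) \in M & e \notin f :: B].
Proof.
move=> uR gG eg Euf; rewrite -szM.
have sB : {subset take (size B) g.2 <= g.2} by move=> z /mem_take.
apply: rotate_block => //.
- exact: block_sub eg.
- exact: block_uniq eg.
- apply: size_takel; rewrite -(reg_size reg gG) eg !size_cat /= size_map.
  by clear; lia.
- move=> d /sB dg; have := reg_path reg gG dg.
  rewrite eg rcons_cat cat_path => /andP[_].
  rewrite rcons_cat cat_path => /andP[+ _] => /= /andP[_].
  rewrite path_map; apply: sub_path => a b /=.
  by rewrite /arcs alt_arcSS.
- rewrite /= take_uniq ?(reg_uniq2 uU reg) // andbT.
  by apply/negP=> /sB; apply/negP; exact: (reg_notinR uU reg).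
- move=> c; rewrite inE -mem_unused => /orP[/eqP->|/sB].
    exact: (reg_subR reg).
  exact: (reg_subU reg).
Qed.

(** The cover tested against [R] and [d] takes right ends before [f] in [g] and left ends elsewhere;
    it omits both ends of [f] and instead contains both ends of the first edge [e'] of [g']. The arc
    avoiding it must be the loop at [f], and [R] contains no loops. *)
Lemma block_loop g q1 f B q2 g' d : g \in G ->
    g.1 = q1 ++ map Some (f :: B) ++ q2 -> g' \in G -> g' != g -> d \in g'.2 ->
  E d f.1 f.2.
Proof.
move=> gG eg g'G gg' dg'; have dU := reg_subU reg g'G dg'.
have ug := reg_uniq1 uV reg gG.
have dg : d \notin g.2.
  by apply: contra gg' => dg; rewrite (reg_disj2 uU reg g'G gG dg' dg).
have dR : d \notin R by apply/negP=> /(reg_notinR uU reg g'G); rewrite dg'.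
have [h1 eh1] : exists h1, q1 = map Some h1.
  apply: (@nodes_map_Some M) => z zq; apply: (reg_subV reg gG).
  by rewrite eg mem_cat zq.
have [e' [r' er']] : exists e' r, g'.1 = Some e' :: r.
  have := reg_neq0 reg g'G; case er : g'.1 => [|y r] // _.
  have [|e' -> _] := @nodesP _ _ M y; last by exists e', r.
  by apply: (reg_subV reg g'G); rewrite er mem_head.
have eg1 : g.1 = map Some (rcons h1 f) ++ map Some B ++ q2.
  by rewrite eg eh1 map_rcons cat_rcons.
have uh : uniq (rcons h1 f).
  by move: ug; rewrite eg1 cat_uniq => /and3P[/map_uniq].
have sh : {subset rcons h1 f <= unzip2 M}.
  move=> e eh; rewrite -mem_nodes; apply: (reg_subV reg gG).
  by rewrite eg1 mem_cat map_f.
(* An arc within [g] that does not advance, starts no later than [f] and does not end before [f] is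
   the loop at [f]. *)
have at_f a1 a2 b1 b2 e1 e2 : g.1 = a1 ++ Some e1 :: a2 ->
    g.1 = b1 ++ Some e2 :: b2 -> size b1 <= size a1 ->
    e1 \in rcons h1 f -> e2 \notin h1 -> e1 = f /\ e2 = f.
  move=> ea eb le e1h e2h.
  have Sinj : injective (@Some (T * T)) by move=> ? ? [].
  have ia := index_split ug ea; have ib := index_split ug eb.
  have lea : size a1 <= size h1.
    rewrite -ia eg1 index_cat mem_map // e1h -ltnS -(size_rcons h1 f).
    by rewrite -(size_map Some) index_mem mem_map.
  have leb : size h1 <= size b1.
    rewrite -ib eg1 -cats1 map_cat -catA index_cat mem_map // (negbTE e2h).
    by rewrite size_map leq_addr.
  have at_h1 c1 c2 e3 : size c1 = size h1 -> g.1 = c1 ++ Some e3 :: c2 -> e3 = f.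
    move=> szc; rewrite eg1 -cats1 map_cat -catA => /(congr1 (fun l => nth None l (size h1))).
    by rewrite !nth_cat size_map szc ltnn subnn /= => -[].
  split; [apply: (at_h1 _ _ _ _ ea)|apply: (at_h1 _ _ _ _ eb)]; move: lea leb le; clear; lia.
pose Y1 := [seq e <- unzip2 M | e \notin rcons h1 f].
have [|||c [x [y [cK Axy xs ys]]]] := @koenig_arc M (rcons R d) Y1 (e' :: h1).
- by rewrite rcons_uniq dR (reg_uniqR uU reg).
- by rewrite size_rcons.
- have := size_filter_notin (uniq_pairs rM) uh sh.
  by rewrite size_rcons size_map -/Y1 /= => ->.
have {}xs : x = None \/ exists2 e, x = Some e & e \in rcons h1 f.
  case: xs => [|[e [ex eM]]]; [by left|].
  by rewrite mem_filter eM andbT negbK => eh; right; exists e.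
have {}ys : y = None \/ exists e, [/\ y = Some e, Some e \in nodes M, e != e' & e \notin h1].
  case: ys => [|[e [ey eM]]]; [by left|rewrite inE negb_or => /andP[? ?]].
  by right; exists e; rewrite mem_nodes.
have xV e : e \in rcons h1 f -> Some e \in nodes M by move=> /sh; rewrite mem_nodes.
have xg e : e \in rcons h1 f -> Some e \in g.1.
  by move=> eh; rewrite eg1 mem_cat map_f.
have ysV : y = None \/ y \in nodes M.
  by case: ys => [|[e [-> ? _ _]]]; [left|right].
move: cK; rewrite mem_rcons inE => /orP[/eqP ec|cR]; last first.
  have xsV : x = None \/ x \in nodes M.
    by case: xs => [|[e -> /xV]]; [left|right].
  have [g1 [a1 [a2 [b1 [b2 [g1G ea eb le]]]]]] := arc_colour_R uU reg nr cR Axy xsV ysV.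
  have g1V := reg_subV reg g1G.
  have xg1 : x \in g1.1 by rewrite ea mem_cat mem_head orbT.
  have yg1 : y \in g1.1 by rewrite eb mem_cat mem_head orbT.
  case: xs => [ex|[e1 ex e1h]]; first by have := None_nodes M; rewrite -ex g1V.
  case: ys => [ey|[e2 [ey _ _ e2h]]]; first by have := None_nodes M; rewrite -ey g1V.
  have egg : g1 = g by apply: (reg_disj1 uV reg g1G gG xg1); rewrite ex xg.
  rewrite {}egg {}ex {}ey in ea eb Axy.
  have [ef1 ef2] := at_f _ _ _ _ _ _ ea eb le e1h e2h.
  move: Axy; rewrite ef1 ef2 /arcs alt_arcSS => Eff.
  have /mapP[[c' e] fM /= ef] : f \in unzip2 M by apply: sh; rewrite mem_rcons mem_head.
  by rewrite -ef in fM; have := no_loop_R cR fM; rewrite Eff.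
rewrite {}ec in Axy.
have only_g' g2 : g2 \in G -> d \in g2.2 -> g2 = g'.
  by move=> g2G dg2; exact: (reg_disj2 uU reg g2G g'G dg2 dg').
have y_not_first g2 r : g2 \in G -> d \in g2.2 -> g2.1 = y :: r -> False.
  move=> g2G dg2 e2; move: e2; rewrite (only_g' _ g2G dg2) er' => -[ey _].
  by move: ys; rewrite -ey => -[//|[e [[<-] _ /eqP]]].
case: xs => [ex|[e1 ex e1h]]; rewrite {}ex in Axy.
  have [g2 [r [g2G dg2 e2]]] := arc_from_start uU reg nr dU Axy ysV.
  by case: (y_not_first _ _ g2G dg2 e2).
case: ys ysV => [ey|[e2 [ey e2V _ e2h]]] ysV.
  rewrite ey in Axy.
  have [g2 [r [g2G dg2 e2]]] := arc_to_end uU reg nr dU Axy (xV _ e1h).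
  have := reg_disj1 uV reg g2G gG _ (xg _ e1h).
  rewrite e2 mem_rcons mem_head => /(_ isT) egg.
  by rewrite egg (negbTE dg) in dg2.
have [b [r1 [r2 [bG eb]]]] := regP reg e2V.
have [a1 [a2 ea]] : exists a1 a2, g.1 = a1 ++ Some e1 :: a2.
  by case/path.splitPr: {2}(g.1) / (xg _ e1h) (erefl g.1) => a1 a2 ea; exists a1, a2.
rewrite ey in Axy; case: (inner_arc uU reg nr dU Axy gG bG ea eb).
- case=> egb; rewrite (negbTE dg) addn0 => le; rewrite -egb in eb.
  have [ef1 ef2] := at_f _ _ _ _ _ _ ea eb le e1h e2h.
  by move: Axy; rewrite ef1 ef2 /arcs alt_arcSS.
- by rewrite (negbTE dg) => -[].
- by case=> db r10; case: (y_not_first _ r2 bG db); rewrite eb r10 ey.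
Qed.

(** A colour of a second group [g'] contains [f], by [block_loop], so by [freed_colour] the colour
    [c] of [f] has an arc from the source into [g']. The switch also removes [f] and frees [c]
    without touching [g'], and then [c] followed by the colours of [g'] gives a rainbow path. *)
Lemma single_group g h : g \in G -> h \in G -> g = h.
Proof.
have [u [g0 [q1 [f [B [q2 [uR g0G eg0 _ Euf]]]]]]] := back_arc.
suff only g' : g' \in G -> g' = g0 by move=> /only-> /only->.
move=> g'G; apply: contrapT => /eqP ng.
have [d dg'] : exists d, d \in g'.2.
  have := reg_neq0 reg g'G; rewrite (reg_size reg g'G).
  by case: (g'.2) => // d l _; exists d; rewrite mem_head.
have Ed := block_loop g0G eg0 g'G ng dg'.
have /mapP[[c f'] fM /= ef] := block_sub g0G eg0 (mem_head f B).
rewrite -{}ef in fM; have dU := reg_subU reg g'G dg'.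
have [y [g1 [Acy g1G yg1 dg1]]] := freed_colour fM dU Ed.
have eg1 := reg_disj2 uU reg g1G g'G dg1 dg'; rewrite {}eg1 in yg1.
have cM : c \in unzip1 M by apply/mapP; exists (c, f).
have [M' [rM' szM' [el er] [pM' _] cM']] := rotation uR g0G eg0 Euf.
have disj z : z \in g'.2 -> z \notin g0.2.
  by move=> zg'; apply: contra ng => zg; rewrite (reg_disj2 uU reg g'G g0G zg' zg).
apply: (no_augment (M := M) (V := g'.1) (cs := c :: g'.2) rM' szM' el er).
- move=> z zg; have [e ez _] := nodesP (reg_subV reg g'G zg).
  rewrite ez mem_nodes; apply: pM'; rewrite mem_filter -mem_nodes -ez.
  rewrite (reg_subV reg g'G) // andbT; apply: contra ng => eB.
  rewrite (reg_disj1 uV reg g'G g0G zg) // eg0 ez mem_cat mem_cat map_f //.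
  by rewrite orbT.
- by rewrite /= used_notin_group // (reg_uniq2 uU reg).
- move=> z; rewrite inE => zg; apply/negP=> /cM'[|[e eM eB]].
    rewrite inE => zu; move: zg => /orP[/eqP ez|zg].
      move: zu; rewrite ez => /orP[/eqP ecu|/mem_take].
        by have := reg_subR reg uR; rewrite mem_unused -ecu cM.
      by apply/negP; exact: used_notin_group.
    case/orP: zu => [/eqP ezu|/mem_take]; last by apply/negP; exact: disj.
    by have := reg_notinR uU reg g'G uR; rewrite -ezu zg.
  case/orP: zg => [/eqP ez|zg].
    move: eB; rewrite -ez in fM.
    (* The colour [c] occurs in [M] only at [f], which lies in the switched block. *)
    have -> : e = f; last by rewrite mem_head.
    by case/and4P: rM => uM _ _ _; have [->] := uniq_map_inj uM eM fM erefl.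
  have := reg_subU reg g'G zg; rewrite mem_unused => /mapP; apply.
  by exists (z, e).
- case/path.splitPr: {2}(g'.1) / yg1 (erefl g'.1) => r1 r2 er1.
  constructor 2; exists y; split=> //; first by rewrite er1 mem_cat mem_head orbT.
  apply: (@rainbow_walk_last _ _ _ _ _ _ r2).
  + by move=> z zr; rewrite er1 mem_cat inE zr !orbT.
  + move=> d' /(reg_path reg g'G).
    by rewrite er1 rcons_cat cat_path /= => /and3P[].
  + by rewrite -(reg_size reg g'G) er1 size_cat /=; clear; lia.
Qed.

End ExtremalTheory.

(* A single group forms a Hamiltonian path, along which an arc of one of its
   own colours advances by at most one position. *)
Lemma short_path_absurd M G R d w : extremal M G R -> d \in unused M ->
    {subset w <= nodes M} -> size w < n.-1 ->
  ~ path (arcs M d) None (rcons w None).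
Proof.
move=> ext dU sw szw; have [rM szM reg szR] := ext.
have uV := nodes_uniq rM; have uU := unused_uniq M.
have nr : no_rainbow (arcs M) (nodes M) None None (unused M).
  move=> cs ucs scs; apply: (no_augment rM szM) => //.
  by move=> c /scs; rewrite mem_unused.
case: w => [|y w] in sw szw *.
  rewrite /= andbT => Ad; have [|g [q [gG _ eg]]] := arc_from_start uU reg nr dU Ad.
    by left.
  have := reg_subV reg gG (x := None); rewrite eg mem_head => /(_ isT) /negPn.
  by rewrite None_nodes.
have yV : y \in nodes M by apply: sw; rewrite mem_head.
move=> pw; have /andP[Ady _] := pw.
have [g [q [gG dg eg]]] := arc_from_start uU reg nr dU Ady (or_intror yV).
have allg h : h \in G -> h = g by move=> hG; exact: (single_group ext hG gG).
have Vg x : x \in nodes M -> x \in g.1.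
  by move=> /(regP reg)[h [r1 [r2 [hG eh]]]]; rewrite -(allg h hG) eh mem_cat mem_head orbT.
have ug := reg_uniq1 uV reg gG.
have idx r1 r2 x : g.1 = r1 ++ x :: r2 -> index x g.1 = size r1 by exact: index_split.
have step x z : x \in g.1 -> z \in g.1 -> arcs M d x z ->
    index z g.1 <= (index x g.1).+1.
  move=> xg zg Axz.
  have [q1 [q2 eq]] : exists q1 q2, g.1 = q1 ++ x :: q2.
    by case/path.splitPr: {2}(g.1) / xg (erefl g.1) => q1 q2 ?; exists q1, q2.
  have [r1 [r2 er]] : exists r1 r2, g.1 = r1 ++ z :: r2.
    by case/path.splitPr: {2}(g.1) / zg (erefl g.1) => r1 r2 ?; exists r1, r2.
  rewrite (idx _ _ _ eq) (idx _ _ _ er).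
  case: (inner_arc uU reg nr dU Axz gG gG eq er) => [[_]|[_ eq2]|[_ ->]//].
    by rewrite dg addn1.
  have := congr1 size er; rewrite eq eq2 !size_cat /=; clear; lia.
have far v x : {subset x :: v <= g.1} -> path (arcs M d) x v ->
    index (last x v) g.1 <= index x g.1 + size v.
  elim: v x => [|z v IH] x sv /=; first by rewrite addn0.
  case/andP=> Axz pv; have zg : z \in g.1 by apply: sv; rewrite !inE eqxx orbT.
  apply: (leq_trans (IH _ _ pv)); first by move=> t tv; apply: sv; rewrite inE tv orbT.
  by rewrite addnS -addSn leq_add2r step // sv ?mem_head.
have swg : {subset y :: w <= g.1} by move=> t /sw/Vg.
move: pw; rewrite /= rcons_path => /and3P[_ pw Al].
have lV : last y w \in nodes M by apply: sw; exact: mem_last.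
have [h [r [hG _ eh]]] := arc_to_end uU reg nr dU Al lV.
rewrite (allg _ hG) -cats1 in eh.
(* The walk starts at position 0 and ends at position [n - 2], advancing by at most one per arc, so
   it has at least [n - 1] vertices. *)
have := far _ _ swg pw; rewrite (idx _ _ _ eh) eg /= eqxx add0n.
have : size (nodes M) <= size g.1 by apply: uniq_leq_size.
rewrite eh size_cat !size_map szM; move: szw => /=; clear; lia.
Qed.

(** The new edge closing the block has the right end of [f] and the left end of the block's last
    edge. A colour of [g] left over by the switch can therefore pass through this one edge instead
    of the whole block. *)
Lemma no_extremal M G R : ~ extremal M G R.
Proof.
move=> ext; have [rM szM reg szR] := ext.
have uV := nodes_uniq rM; have uU := unused_uniq M.
have [u [g [q1 [f [B [q2 [uR gG eg B0 Euf]]]]]]] := back_arc ext.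
have [M' [rM' szM' [el er] [pM' fM'] cM']] := rotation ext uR gG eg Euf.
have [G' [R' ext']] := extremal_exists rM' szM'.
have szg : size g.1 = (size q1 + size q2 + size B).+1.
  by rewrite eg !size_cat /= size_map; clear; lia.
(* The switch uses [size B] colours of [g], and the block alone already has [size B + 1] vertices,
   so a colour [d] is left. *)
case ed : (drop (size B) g.2) => [|d l].
  have := congr1 size ed; rewrite size_drop -(reg_size reg gG) szg /=.
  by clear; lia.
have dg : d \in g.2 by apply: (@mem_drop (size B)); rewrite ed mem_head.
have dt : d \notin take (size B) g.2.
  have := reg_uniq2 uU reg gG; rewrite -{1}(cat_take_drop (size B) g.2) ed cat_uniq.
  by case/and3P=> _ /= /norP[].
have dU : d \in unused M'.
  rewrite mem_unused; apply/negP=> /cM'[|[e eM _]].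
    rewrite inE (negbTE dt) orbF => /eqP edu.
    by have := reg_notinR uU reg gG uR; rewrite -edu dg.
  have := reg_subU reg gG dg; rewrite mem_unused => /mapP; apply.
  by exists (d, e).
have ug := reg_uniq1 uV reg gG.
have old z : z \in g.1 -> z \notin map Some (f :: B) -> z \in nodes M'.
  move=> zg; have [e ez _] := nodesP (reg_subV reg gG zg); rewrite ez in zg * => eB.
  rewrite mem_nodes; apply: pM'; rewrite mem_filter.
  have := reg_subV reg gG zg; rewrite mem_nodes => ->; rewrite andbT.
  by apply: contra eB => eB; rewrite map_f.
have := ug; rewrite eg cat_uniq cat_uniq => /and3P[_ d1 /and3P[_ d2 _]].
apply: (@short_path_absurd M' G' R' d
  (q1 ++ Some ((last f B).1, f.2) :: q2) ext' dU).
- move=> z; rewrite mem_cat inE => /or3P[zq|/eqP->|zq].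
  + apply: old; first by rewrite eg mem_cat zq.
    apply: contraL zq => zB; move/hasPn: d1; apply.
    by rewrite mem_cat zB.
  + by rewrite mem_nodes.
  + apply: old; first by rewrite eg !mem_cat zq !orbT.
    by move/hasPn: d2; apply.
- have : size g.1 <= size (nodes M).
    by apply: uniq_leq_size => // z; exact: (reg_subV reg gG).
  rewrite szg !size_map szM size_cat /=.
  by case: (B) B0 => //= ? ? _; clear; lia.
- have := reg_path reg gG dg; rewrite eg /arcs (eq_alt_arc _ el er).
  have eql x z : tail_at (lefts M) x =1 tail_at (lefts M) z ->
      forall y, alt_arc E (lefts M) (rights M) d x y = alt_arc E (lefts M) (rights M) d z y.
    by move=> e y; apply/asboolP/asboolP => -[a [b [ha hb Eab]]]; exists a, b;
      split=> //; rewrite ?e // -e.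
  rewrite !rcons_cat !cat_path /= => /and3P[-> /andP[Af _] p2].
  rewrite last_map in p2; rewrite /=.
  apply/andP; split.
    move: Af => /asboolP[a [b [ha hb Eab]]]; apply/asboolP; exists a, b.
    by split.
  case: (q2) p2 => [|y r] /=;
    rewrite (eql (Some (last f B)) (Some ((last f B).1, f.2)) (fun=> erefl)) //.
Qed.

Lemma no_rmatching_absurd : False.
Proof.
have [M rM szM] := rmatching_pred; have [G [R ext]] := extremal_exists rM szM.
exact: no_extremal ext.
Qed.

End Extremal.

Theorem rmatching_exists (C : finType) (T : eqType) (E : C -> rel T) (n k : nat) :
    1 < k -> k <= n -> #|C| = 2 * n + k - 3 ->
    (forall c, exists a b, E c a b) ->
    (forall K : seq C, uniq K -> size K = k ->
      forall LA LB : seq T, size LA + size LB < n ->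
      exists c a b, [/\ c \in K, E c a b, a \notin LA & b \notin LB]) ->
  exists2 M, rmatching E M & size M = n.
Proof.
move=> k1 kn cC E0 koenig; apply: contrapT => no.
by apply: (@no_rmatching_absurd C T E n k) => // M rM szM; apply: no; exists M.
Qed.

(** * Translation to sets of edges of a bipartite graph *)

Unset Implicit Arguments.
Set Strict Implicit.

Local Open Scope fset_scope.
Local Open Scope classical_set_scope.

Theorem theorem1p8 (V : choiceType) (G : sgraph V) (n k : nat)
    (F : 'I_(2 * n + k - 3)%N -> set {fset V}) :
  bipartite G ->
  (1 < k <= n)%N ->
  (forall i, F i `<=` edges G) ->
  (forall i, F i !=set0) ->
  (forall S : {set 'I_(2 * n + k - 3)%N}, #|S| = k ->
     exists M : {fset {fset V}},
       [/\ [set` M] `<=` \bigcup_(i in [set` S]) F i,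
           matching G M & #|` M| = n]) ->
  exists M : {fset {fset V}},
    [/\ rainbow_set F M, matching G M & #|` M| = n].
Proof.
move=> [A bipA] /andP[k1 kn] FG F0 kM.
(* Edges are oriented so that the left end is the one in [A]. *)
pose E c a b := `[< [/\ adj G a b, A a & F c [fset a; b]] >].
have oriented c e : F c e -> exists a b, E c a b /\ e = [fset a; b].
  move=> Fe; have [x [y [Gxy ee]]] := FG _ _ Fe.
  have [Ax|nAx] := pselect (A x).
    by exists x, y; split=> //; apply/asboolP; rewrite -ee.
  exists y, x; rewrite fsetUC -ee; split=> //; apply/asboolP; split=> //.
  - by rewrite (adj_sym G).
  - by apply: contrapT => nAy; apply/nAx/(bipA _ _ Gxy).
  - by rewrite fsetUC -ee.
have notA c a b : E c a b -> ~ A b.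
  by move=> /asboolP[Gab Aa _]; apply/(bipA _ _ Gab).
have EA c a b : E c a b -> A a by move=> /asboolP[].
have [|c|K uK szK LA LB szL|M rM szM] := @rmatching_exists _ _ E n k k1 kn.
- by rewrite card_ord.
- have [e Fe] := F0 c; have [a [b [Eab _]]] := oriented _ _ Fe.
  by exists a, b.
- have [|N [NF [_ disN] szN]] := kM [set c in K].
    by rewrite cardsE (card_uniqP uK).
  apply: contrapT => no.
  (* Otherwise mapping each edge of N to an endpoint in LA or LB is injective. *)
  have [|phi phiP] := @choice _ _ (fun (e : {fset V}) (v : option V) =>
      e \in N -> exists w, [/\ v = Some w, w \in LA ++ LB & w \in e]).
    move=> e; have [eN|_] := boolP (e \in N); last by exists None.
    have [c /= cK Fce] := NF _ eN; rewrite inE in cK.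
    have [a [b [Eab ee]]] := oriented _ _ Fce.
    have [aL|aL] := boolP (a \in LA).
      by exists (Some a) => _; exists a; rewrite mem_cat aL ee !inE eqxx.
    have [bL|bL] := boolP (b \in LB).
      by exists (Some b) => _; exists b; rewrite mem_cat bL ee !inE eqxx !orbT.
    by case: no; exists c, a, b.
  have : size (map phi N) <= size (map Some (LA ++ LB)).
    apply: uniq_leq_size.
      rewrite map_inj_in_uniq ?fset_uniq // => e f eN fN epf.
      have [w [ew _ we]] := phiP _ eN; have [w' [ew' _ wf]] := phiP _ fN.
      move: epf; rewrite ew ew' => -[eww]; apply: contrapT => /eqP nef.
      by have /fdisjointP/(_ _ we) := disN _ _ eN fN nef; rewrite eww wf.
    move=> _ /mapP[e eN ->]; have [w [-> wL _]] := phiP _ eN; exact: map_f.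
  by rewrite !size_map size_cat szN leqNgt szL.
pose edge (z : 'I_(2 * n + k - 3) * (V * V)) := [fset z.2.1; z.2.2].
have [uC uL uR /allP EM] := and4P rM.
(* Left ends lie in [A] and right ends outside it, so two edges can meet only at ends of the same
   side, where [rmatching] separates them. *)
have edge_meet z z' v : z \in M -> z' \in M -> v \in edge z -> v \in edge z' -> z = z'.
  move=> zM z'M; have /EA Az := EM _ zM; have /EA Az' := EM _ z'M.
  have /notA nAz := EM _ zM; have /notA nAz' := EM _ z'M.
  rewrite !inE => /orP[]/eqP-> /orP[]/eqP e.
  - apply: (uniq_map_inj (f := fun y => y.2.1) (l := M)) e => //.
    by move: uL; rewrite /lefts /unzip1 /unzip2 -map_comp.
  - by case: nAz'; rewrite -e.
  - by case: nAz; rewrite e.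
  - apply: (uniq_map_inj (f := fun y => y.2.2) (l := M)) e => //.
    by move: uR; rewrite /rights /unzip2 -map_comp.
have memN e : (e \in [fset x in map edge M]) = (e \in map edge M) by rewrite !inE.
exists [fset x in map edge M]; split.
(* At most one entry of [M] has colour [i], so [ohead] loses nothing. *)
- exists (fun i => omap edge (ohead [seq z <- M | z.1 == i])); split=> [i e|e].
    case ez : [seq z <- M | z.1 == i] => [|z l] //= [<-].
    have : z \in [seq z <- M | z.1 == i] by rewrite ez mem_head.
    by rewrite mem_filter => /andP[/eqP<- /EM /asboolP[]].
  rewrite memN; split=> [/mapP[z zM ->]|[i]].
    exists z.1; case ez : [seq y <- M | y.1 == z.1] => [|y l] /=.
      have : z \in [seq y <- M | y.1 == z.1] by rewrite mem_filter eqxx.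
      by rewrite ez.
    have : y \in [seq y <- M | y.1 == z.1] by rewrite ez mem_head.
    rewrite mem_filter => /andP[/eqP eyz yM].
    by rewrite (uniq_map_inj (f := fst) uC yM zM eyz).
  case ez : [seq z <- M | z.1 == i] => [|z l] //= [<-].
  apply: map_f; have : z \in [seq z <- M | z.1 == i] by rewrite ez mem_head.
  by rewrite mem_filter => /andP[].
- split=> [e /=|e f]; rewrite !memN.
    move=> /mapP[z /EM /asboolP[Gz _ _] ->].
    by exists z.2.1, z.2.2.
  move=> /mapP[z zM ->] /mapP[z' z'M ->] nzz'; apply/fdisjointP => v vz.
  by apply: contra nzz' => vz'; rewrite (edge_meet z z' v).
- rewrite card_fseq undup_id ?size_map // map_inj_in_uniq; first exact: map_uniq uC.
  move=> z z' zM z'M e.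
  by apply: (edge_meet z z' z.2.1); rewrite -?e // !inE eqxx.
Qed.
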